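(* If $y>\exp(4.2\sqrt{\log x})$, then there exists a positive constant $c_{13}$ such that, as $x\to\infty$, $$ \frac1y\sum_{a\leq y}N_a(x)=\sum_{n\leq x}\frac{R(n)}{n}+O\!\left(x\exp(-c_{13}\sqrt{\log x})\right). $$
   Context: $a$ and $n$ run over positive integers. Carmichael's function $\lambda(n)$ is the exponent of the group $(\mathbb{Z}/n\mathbb{Z})^*$. For $a$ coprime to $n$, $\ell_a(n)$ is the multiplicative order of $a$ modulo $n$, and $a$ is called a $\lambda$-primitive root modulo $n$ if $\gcd(a,n)=1$ and $\ell_a(n)=\lambda(n)$. $R(n)=\#\{a\in(\mathbb{Z}/n\mathbb{Z})^*: a \text{ is a } \lambda\text{-primitive root modulo } n\}$ and $N_a(x)=\#\{n\leq x: a \text{ is a } \lambda\text{-primitive root modulo } n\}$. *)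

(* Defs.v *)
From HB Require Import structures.
From mathcomp Require Import all_boot all_order all_algebra.
From mathcomp Require Import all_classical all_reals all_analysis.
Set Implicit Arguments. Unset Strict Implicit. Unset Printing Implicit Defensive.

(* multiplicative order of a modulo n (for gcd(a,n)=1, n >= 1):
   the least k >= 1 with a^k = 1 (mod n); such k <= totient n <= n exists. *)
Definition ordmod (n a : nat) : nat :=
  (find (fun k => a ^ k.+1 == 1 %[mod n]) (iota 0 n)).+1.

Definition carmichael (n : nat) : nat :=
  \big[lcmn/1%N]_(a < n | coprime a n) ordmod n a.

Definition lprim (a n : nat) : bool :=
  coprime a n && (ordmod n a == carmichael n).

Definition Rcount (n : nat) : nat := #|[set a : 'I_n | lprim a n]|.

Definition Ncount (a X : nat) : nat := #|[set n : 'I_X.+1 | (0 < n)%N && lprim a n]|.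

(* Main.v *)
Require Import Defs.
From HB Require Import structures.
From mathcomp Require Import all_boot all_order all_algebra.
From mathcomp Require Import all_fingroup all_solvable all_field all_character.
From mathcomp Require Import all_classical all_reals all_analysis.
From mathcomp Require Import zify ring lra.
Import Order.TTheory GRing.Theory Num.Theory.
Set Implicit Arguments. Unset Strict Implicit. Unset Printing Implicit Defensive.
Local Open Scope ring_scope.

(** Write [X], [Y] for the integer parts of [x], [y] and [lam] for the Carmichael
    function.  A residue [a] coprime to [n] is a lambda-primitive root iff
    [a ^ (lam n / q)] differs from 1 for every prime [q] dividing [lam n], so Bonferroni's
    inequalities, truncated at about [sqrt (ln x) / ln (ln x)] primes, reduce the theorem
    to counting the [a <= Y] in subgroups [H] of the units modulo [n], on average over
    [n <= X].

    The indicator of [H] is the mean of the characters trivial on [H].  A character of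
    conductor [d < z], where [z] is about [Y ^ (1/10)], is summed by periodicity.  For
    [z ^ r <= d < z ^ (r+1)] the [r]-th power of the character sum is estimated by a
    large sieve inequality that follows from duality and periodicity alone: two distinct
    primitive characters of conductors [d], [d'] have correlation at most [d * d'], up to
    the sieve by the primes dividing the moduli.  The resulting saving is [z ^ r], against
    the number of solutions of [a_1 ... a_r = b_1 ... b_r] in integers up to [Y].  Here [r]
    may be a constant multiple of [ln Y], so a loss [C ^ (r * r)] with [C] fixed would be
    fatal.  The part of the variables composed of the primes up to [P] is therefore counted
    trivially; the part free of them is parametrized by [r * r] matrices of integers and
    bounded by Rankin's trick, which loses [C ^ (r * r)] with [C] close to 1 for large
    [P]. *)

(** * Divisibility *)

(** The number of primes dividing [carmichael n] is only bounded by [log_2 X], so complete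
    inclusion-exclusion could involve up to [X] subgroups for one [n]; hence the truncation. Put
    [s = sqrt (ln x)]. Keeping sets of about [s / (100 * ln s)] primes leaves at most [exp (s / 25)]
    subgroups per modulus. The worst of them is chosen separately for each [n], so equidistribution
    on average is proved for an arbitrary choice of one subgroup per modulus, with a saving of
    [exp (s / 20)].

    Powers are counted in terms of [w], the integer part of [Y ^ (1/40)], with [z = w ^ 4]. In the
    [2r]-th moment the level [r] saves [z ^ r = w ^ (4r)], the energy may waste [w ^ (2r)], and the
    remaining [w ^ (2r)] amounts to a factor [w] per character sum, of which [w ^ (1/2)] is finally
    kept. The constant 4.2 exceeds 4 just to ensure [w >= exp (s / 10)] after rounding; then
    [w ^ (1/2) >= exp (s / 20)] beats the number of subgroups. *)

Lemma coprime_rep c D N : (0 < N)%N -> coprime c D ->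
  exists m, (m = c %[mod D])%N /\ coprime m N.
Proof.
move=> N0 cD.
have [c0|c0] := posnP c.
  exists 1%N; split; last exact: coprime1n.
  by move: cD; rewrite c0 /coprime gcd0n => /eqP ->; rewrite !modn1.
(* A prime dividing [N] divides exactly one of the two terms: if it divides [c], it divides neither
   [D] nor the part of [N] prime to [c]; otherwise it divides that part. *)
exists (c + D * N`_(\pi(c)^'))%N; split; first by rewrite addnC mulnC modnMDl.
rewrite coprime_has_primes //; last by rewrite addn_gt0 c0.
apply/hasPn => p; rewrite mem_primes => /and3P [pp _ pN].
rewrite /= mem_primes pp addn_gt0 c0 /=.
have pt : (p %| N`_(\pi(c)^'))%N = ~~ (p %| c)%N.
  have -> : (p %| N`_(\pi(c)^'))%N = (p \in primes N`_(\pi(c)^')).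
    by rewrite mem_primes pp part_gt0.
  by rewrite primes_part mem_filter mem_primes pp N0 pN !inE mem_primes pp c0 /= andbT.
have [pc|pc] := boolP (p %| c)%N.
  rewrite dvdn_addr // Euclid_dvdM // negb_or pt pc andbT.
  by apply: contraTN cD => pD; apply/negP => /(coprime_dvdl pc); rewrite prime_coprime // pD.
by rewrite dvdn_addl // dvdn_mull // pt.
Qed.

(** The last factor absorbs [gcdn b (f r)]; the rest of [b] is coprime to the cofactor of [f r],
    hence divides the product of the other factors. *)
Lemma dvdn_prod_split r (f : nat -> nat) b : (0 < b)%N -> (b %| \prod_(i < r) f i)%N ->
  exists e : nat -> nat, (forall i, (i < r)%N -> e i %| f i)%N /\ (\prod_(i < r) e i)%N = b.
Proof.
elim: r b => [|r IH] b b0.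
  by rewrite big_ord0 dvdn1 => /eqP ->; exists (fun=> 1%N); rewrite big_ord0.
rewrite big_ord_recr /= => H.
have g0 : (0 < gcdn b (f r))%N by rewrite gcdn_gt0 b0.
have [||e [He1 He2]] := IH (b %/ gcdn b (f r))%N.
- by rewrite divn_gt0 // dvdn_leq ?dvdn_gcdl.
- rewrite -(@Gauss_dvdl _ _ (f r %/ gcdn b (f r))); last first.
    rewrite /coprime -(eqn_pmul2r g0) muln_gcdl !divnK ?dvdn_gcdl ?dvdn_gcdr //.
    by rewrite mul1n.
  rewrite -(@dvdn_pmul2r (gcdn b (f r))) // -mulnA !divnK ?dvdn_gcdl ?dvdn_gcdr //.
exists (fun i => if i == r then gcdn b (f r) else e i); split.
  move=> i; case: eqVneq => [->|ne] ir; first exact: dvdn_gcdr.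
  by apply: He1; rewrite ltn_neqAle ne -ltnS.
rewrite big_ord_recr /= eqxx.
rewrite (eq_bigr (fun i : 'I_r => e i)) ?He2 ?divnK ?dvdn_gcdl //.
by move=> i _; rewrite ltn_eqF.
Qed.

(** The last column is a splitting of [g s] along the [f i]; dividing it out leaves one column
    fewer. *)
Lemma matrix_factorization r s (f g : nat -> nat) : (forall i, (i < r)%N -> 0 < f i)%N ->
  (\prod_(i < r) f i = \prod_(j < s) g j)%N ->
  exists G : nat -> nat -> nat,
    (forall i, (i < r)%N -> f i = \prod_(j < s) G i j)%N /\
    (forall j, (j < s)%N -> g j = \prod_(i < r) G i j)%N.
Proof.
elim: s f => [|s IH] f f0.
  rewrite big_ord0 => H; exists (fun _ _ => 1%N); split => // i ir.
  rewrite big_ord0; apply/eqP; rewrite -dvdn1 -H.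
  by rewrite (bigD1 (Ordinal ir)) //= dvdn_mulr.
rewrite big_ord_recr /= => H.
have P0 : (0 < \prod_(i < r) f i)%N by apply: prodn_gt0 => i; exact: f0.
have g0 : (0 < g s)%N by move: P0; rewrite H muln_gt0 => /andP[].
have [e [He1 He2]] : exists e : nat -> nat,
    (forall i, (i < r)%N -> e i %| f i)%N /\ (\prod_(i < r) e i)%N = g s.
  by apply: dvdn_prod_split => //; rewrite H dvdn_mull.
have [||G [HG1 HG2]] := IH (fun i => f i %/ e i)%N.
- move=> i ir; rewrite divn_gt0; first by rewrite dvdn_leq ?f0 ?He1.
  by apply: (dvdn_gt0 (f0 _ ir)); exact: He1.
- apply/eqP; rewrite -(eqn_pmul2r g0) -H -{1}He2 -big_split /=.
  by apply/eqP/eq_bigr => i _; rewrite divnK ?He1.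
exists (fun i j => if j == s then e i else G i j); split.
  move=> i ir; rewrite big_ord_recr /= eqxx.
  rewrite (eq_bigr (fun j : 'I_s => G i j)); last by move=> j _; rewrite ltn_eqF.
  by rewrite -HG1 // divnK // He1.
move=> j; case: eqVneq => [->|ne] js; first by rewrite He2.
by apply: HG2; rewrite ltn_neqAle ne -ltnS.
Qed.

(** * Dirichlet characters and conductors *)

Definition dirichlet (n : nat) (chi : nat -> algC) : Prop :=
  [/\ (0 < n)%N, (forall a b, chi (a * b)%N = chi a * chi b),
      (forall a b, (a = b %[mod n])%N -> chi a = chi b),
      (forall a, coprime a n -> `|chi a| = 1) &
      (forall a, ~~ coprime a n -> chi a = 0)].

Definition agree (m : nat) (chi : nat -> algC) (n : nat) (psi : nat -> algC) : Prop :=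
  forall a, coprime a m -> coprime a n -> chi a = psi a.

(** Minimality ranges over all moduli, not only the divisors of [d], which makes uniqueness a matter
    of antisymmetry; that the conductor divides the modulus is recovered from [agree_gcd]. *)
Definition primitive (d : nat) (psi : nat -> algC) : Prop :=
  dirichlet d psi /\
  forall d' psi', dirichlet d' psi' -> agree d psi d' psi' -> (d <= d')%N.

Lemma coprime_congr a b n : (a = b %[mod n])%N -> coprime a n = coprime b n.
Proof. by move=> ab; rewrite -coprime_modl ab coprime_modl. Qed.

Lemma eqmod_dvdn a b m n : (m %| n)%N -> (a = b %[mod n])%N -> (a = b %[mod m])%N.
Proof. by move=> mn ab; rewrite -(modn_dvdm a mn) ab modn_dvdm. Qed.

Lemma dirichlet1 n chi : dirichlet n chi -> chi 1%N = 1.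
Proof.
move=> [n0 cM cP c1 _]; have := c1 1%N (coprime1n _) => H.
have nz : chi 1%N != 0 by rewrite -normr_eq0 H oner_neq0.
by apply: (mulfI nz); rewrite mulr1 -cM.
Qed.

Lemma dirichlet_norm_le1 n chi a : dirichlet n chi -> `|chi a| <= 1.
Proof.
move=> [_ _ _ c1 c0]; case: (boolP (coprime a n)) => H; first by rewrite c1.
by rewrite c0 // normr0 ler01.
Qed.

Lemma agree_sym m chi n psi : agree m chi n psi -> agree n psi m chi.
Proof. by move=> H a an am; rewrite H. Qed.

(** An [a] coprime to [n1] and [n3] may share a factor with [n2]; it is first moved within its class
    modulo [n1 * n3] to become coprime to [n2]. *)
Lemma agree_trans n1 c1 n2 c2 n3 c3 :
  dirichlet n1 c1 -> dirichlet n2 c2 -> dirichlet n3 c3 ->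
  agree n1 c1 n2 c2 -> agree n2 c2 n3 c3 -> agree n1 c1 n3 c3.
Proof.
move=> [_ _ P1 _ _] [n2_gt0 _ _ _ _] [_ _ P3 _ _] H12 H23 a a1 a3.
have [|b [ab b2]] := @coprime_rep a (n1 * n3) n2 n2_gt0; first by rewrite coprimeMr a1.
have ab1 : (b = a %[mod n1])%N by apply: eqmod_dvdn ab; exact: dvdn_mulr.
have ab3 : (b = a %[mod n3])%N by apply: eqmod_dvdn ab; exact: dvdn_mull.
rewrite -(P1 _ _ ab1) -(P3 _ _ ab3) H12 ?H23 //.
  by rewrite (coprime_congr ab3).
by rewrite (coprime_congr ab1).
Qed.

(** The Chinese remainder theorem for non-coprime moduli gives [c] congruent to [v] modulo [n1] and
    to [u] modulo [n2]; then [c1 v = c1 c = c2 c = c2 u = c1 u]. *)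
Lemma agree_gcd_congr n1 c1 n2 c2 u v :
  dirichlet n1 c1 -> dirichlet n2 c2 -> agree n1 c1 n2 c2 ->
  (u = v %[mod gcdn n1 n2])%N -> coprime u (n1 * n2) -> coprime v (n1 * n2) ->
  c1 u = c1 v.
Proof.
move=> [n1_gt0 _ P1 _ _] [n2_gt0 _ P2 _ _] H12.
wlog uv : u v / (u <= v)%N.
  move=> W; case: (leqP u v) => [|/ltnW] uv H Hu Hv; first exact: W.
  by apply/esym; apply: W.
move/eqP; rewrite eq_sym eqn_mod_dvd // => /dvdnP [q Hq].
rewrite !coprimeMr => /andP [u1 u2] /andP [v1 v2].
have [a _ Ha] := Bezoutl n1 n2_gt0.
have Hv : v = (u + q * gcdn n1 n2)%N by lia.
set c := (v + n1 * (a * q))%N.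
have cv : (c = v %[mod n1])%N by rewrite /c addnC mulnC modnMDl.
have cu : (c = u %[mod n2])%N.
  rewrite /c Hv; have -> : (u + q * gcdn n1 n2 + n1 * (a * q) =
     q * (gcdn n2 n1 + a * n1) + u)%N by rewrite [gcdn n2 n1]gcdnC; nia.
  by move/dvdnP: Ha => [k ->]; rewrite mulnA modnMDl.
by rewrite -(P1 _ _ cv) (H12 u) // (H12 c) ?(P2 _ _ cu) // ?(coprime_congr cv) ?(coprime_congr cu).
Qed.

Lemma agree_gcd n1 c1 n2 c2 :
  dirichlet n1 c1 -> dirichlet n2 c2 -> agree n1 c1 n2 c2 ->
  exists c, dirichlet (gcdn n1 n2) c /\ agree (gcdn n1 n2) c n1 c1.
Proof.
move=> D1 D2 H12; have [n1_gt0 M1 P1 N1 Z1] := D1; have [n2_gt0 _ _ _ _] := D2.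
set g := gcdn n1 n2.
have n12 : (0 < n1 * n2)%N by rewrite muln_gt0 n1_gt0.
have /boolp.choice [rep Hrep] : forall a, exists b, coprime a g ->
    (b = a %[mod g])%N /\ coprime b (n1 * n2).
  move=> a; case: (boolP (coprime a g)) => [ag|_]; last by exists 0%N.
  by have [b Hb] := coprime_rep n12 ag; exists b.
have wd u v := @agree_gcd_congr n1 c1 n2 c2 u v D1 D2 H12.
exists (fun a => if coprime a g then c1 (rep a) else 0); split; first split.
- by rewrite gcdn_gt0 n1_gt0.
- move=> a b; rewrite coprimeMl.
  case: (boolP (coprime a g)) => [ag|_] /=; last by rewrite mul0r.
  case: (boolP (coprime b g)) => [bg|_] /=; last by rewrite mulr0.
  have [Ra1 Ra2] := Hrep _ ag; have [Rb1 Rb2] := Hrep _ bg.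
  have abg : coprime (a * b) g by rewrite coprimeMl ag.
  have [Rab1 Rab2] := Hrep _ abg.
  rewrite -M1; apply: wd => //; last by rewrite coprimeMl Ra2.
  by rewrite Rab1 -(modnMml a b) -Ra1 modnMml -(modnMmr (rep a) b) -Rb1 modnMmr.
- move=> a b ab; rewrite (coprime_congr ab).
  case: ifP => // bg; have ag : coprime a g by rewrite (coprime_congr ab).
  have [Ra1 Ra2] := Hrep _ ag; have [Rb1 Rb2] := Hrep _ bg.
  by apply: wd => //; rewrite Ra1 ab Rb1.
- move=> a ag; rewrite ag; apply: N1.
  by have [_] := Hrep _ ag; rewrite coprimeMr => /andP[].
- by move=> a /negbTE ->.
move=> a ag a1; rewrite ag; have [Ra1 Ra2] := Hrep _ ag.
have [b [ab b2]] := coprime_rep n2_gt0 a1.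
rewrite -(P1 _ _ ab); apply: wd => //.
  by rewrite Ra1; apply/esym; apply: eqmod_dvdn ab; exact: dvdn_gcdl.
by rewrite coprimeMr b2 (coprime_congr ab) a1.
Qed.

(* Take [d] least among the moduli of the characters agreeing with [chi]; agree_gcd then forces [d %| n]. *)
Lemma primitive_exists n chi : dirichlet n chi ->
  exists d psi, [/\ primitive d psi, (d %| n)%N &
    forall a, chi a = psi a * (coprime a n)%:R].
Proof.
move=> Dn.
have ex : exists d, `[< exists psi, dirichlet d psi /\ agree d psi n chi >].
  by exists n; apply/asboolP; exists chi.
case: (ex_minnP ex) => d /asboolP [psi [Dpsi Hpsi]] dmin.
have dn : (d %| n)%N.
  have [c [Dc Hc]] := agree_gcd Dpsi Dn Hpsi.
  have : (d <= gcdn d n)%N.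
    apply: dmin; apply/asboolP; exists c; split => //.
    exact: (agree_trans Dc Dpsi Dn).
  move=> H; have d0 : (0 < d)%N by case: Dpsi.
  have := dvdn_leq d0 (dvdn_gcdl d n) => H2.
  have -> : d = gcdn d n by lia.
  exact: dvdn_gcdr.
exists d, psi; split => //.
  split=> // d' psi' D' H'; apply: dmin; apply/asboolP; exists psi'; split=> //.
  by apply: (agree_trans D' Dpsi Dn) => //; exact: agree_sym.
move=> a; case: (boolP (coprime a n)) => an; last first.
  by rewrite mulr0; case: Dn => _ _ _ _ ->.
by rewrite mulr1 Hpsi //; exact: coprime_dvdr dn an.
Qed.

Lemma primitive_unique d psi d' psi' : primitive d psi -> primitive d' psi' ->
  agree d psi d' psi' -> d = d' /\ psi =1 psi'.
Proof.
move=> [D min] [D' min'] H.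
have dd' : d = d'.
  by apply/eqP; rewrite eqn_leq (min _ _ D' H) (min' _ _ D (agree_sym H)).
split=> // a; rewrite -dd' in D' H.
case: (boolP (coprime a d)) => ad; first exact: H.
by case: D => _ _ _ _ ->; case: D' => // _ _ _ _ ->.
Qed.

Lemma dirichlet_mul_conj d psi d' psi' : dirichlet d psi -> dirichlet d' psi' ->
  dirichlet (d * d') (fun a => psi a * (psi' a)^*).
Proof.
move=> [d0 M P N Z] [d0' M' P' N' Z']; split.
- by rewrite muln_gt0 d0.
- by move=> a b; rewrite M M' rmorphM mulrACA.
- move=> a b ab; rewrite (P a b) ?(P' a b) //; apply: eqmod_dvdn ab.
    exact: dvdn_mull.
  exact: dvdn_mulr.
- move=> a; rewrite coprimeMr => /andP [ad ad'].
  by rewrite normrM N // mul1r norm_conjC N'.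
move=> a; rewrite coprimeMr negb_and => /orP [] H.
  by rewrite Z // mul0r.
by rewrite Z' // rmorph0 mulr0.
Qed.

Lemma dirichlet_sum_period n chi g : dirichlet n chi -> coprime g n -> chi g != 1 ->
  \sum_(m < n) chi m = 0.
Proof.
move=> [n0 M P N Z] gn g1.
have inj : injective (fun m : 'I_n => Ordinal (ltn_pmod (g * m) n0)).
  move=> m m' /(congr1 val) /= /eqP H; apply/val_inj => /=; apply/eqP.
  wlog mm : m m' H / (m <= m')%N.
    move=> W; case: (leqP m m') => [|/ltnW] mm; first exact: W.
    by rewrite eq_sym; apply: W => //; rewrite eq_sym.
  move: H; rewrite eq_sym eqn_mod_dvd; last by rewrite leq_mul2l mm orbT.
  rewrite -mulnBr Gauss_dvdr; last by rewrite coprime_sym.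
  move=> /dvdnP [k Hk]; have := ltn_ord m'; case: k Hk => [|k] Hk ?; lia.
have : chi g * \sum_(m < n) chi m = \sum_(m < n) chi m.
  rewrite [RHS](reindex_inj inj) /= mulr_sumr; apply: eq_bigr => m _.
  by rewrite -M; apply: P; rewrite modn_mod.
move/eqP; rewrite -subr_eq0 -{2}[\sum_(m < n) _]mul1r -mulrBl mulf_eq0 subr_eq0 (negbTE g1).
by move/eqP.
Qed.

(** Whole periods cancel and the rest is bounded trivially; [g] certifies that [chi] is
    nonprincipal. *)
Lemma dirichlet_sum_bound n chi g M : dirichlet n chi -> coprime g n -> chi g != 1 ->
  `|\sum_(1 <= m < M.+1) chi m| <= n%:R.
Proof.
move=> D gn g1; have [n0 _ P N Z] := D.
have S0 := dirichlet_sum_period D gn g1.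
have n1 : (1 < n)%N.
  rewrite ltn_neqAle n0 andbT; apply: contraNneq g1 => n1.
  by rewrite -(dirichlet1 D); apply/eqP; apply: P; rewrite -n1 !modn1.
have c0 : chi 0%N = 0 by apply: Z; rewrite /coprime gcd0n; lia.
have -> : \sum_(1 <= m < M.+1) chi m = \sum_(0 <= m < M.+1) chi m.
  by rewrite [RHS]big_nat_recl // c0 add0r big_add1.
elim/ltn_ind: M.+1 => K IH; case: (ltnP K n) => Kn.
  apply: le_trans (ler_norm_sum _ _ _) _.
  apply: (@le_trans _ _ (\sum_(0 <= i < K) 1)).
    by apply: ler_sum => i _; exact: dirichlet_norm_le1 D.
  by rewrite big_const_nat iter_addr_0 subn0 ler_nat ltnW.
rewrite (big_cat_nat (n := n)) //= big_mkord S0 add0r.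
rewrite -{1}[n]add0n big_addn (eq_bigr chi); first by apply: IH; lia.
by move=> i _; apply: P; rewrite modnDr.
Qed.

(** * Sieving by the primes dividing a modulus *)

Lemma big_dvdn_nat (V : nmodType) p M (f : nat -> V) : (0 < p)%N ->
  \sum_(1 <= m < M.+1 | (p %| m)%N) f m = \sum_(1 <= m < (M %/ p).+1) f (p * m)%N.
Proof.
move=> p0; elim: M => [|M IH]; first by rewrite div0n !big_geq.
rewrite big_mkcond big_nat_recr //= -big_mkcond IH divnS //.
case: (boolP (p %| M.+1)%N) => H /=; last by rewrite add0n addr0.
rewrite add1n [RHS]big_nat_recr //=; congr (_ + f _).
by rewrite -(divnK H) divnS // H add1n mulnC.
Qed.

Definition sieved (ps : seq nat) (m : nat) : bool := all (fun p => ~~ (p %| m)%N) ps.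

Lemma sieved_coprime n m : (0 < n)%N -> (0 < m)%N -> sieved (primes n) m = coprime m n.
Proof.
move=> n0 m0; rewrite coprime_has_primes // -all_predC /sieved.
apply: eq_in_all => p; rewrite mem_primes => /and3P [pp _ _] /=.
by rewrite mem_primes pp m0.
Qed.

Lemma sieved_cons (V : zmodType) (f : nat -> V) p ps M :
  all prime (p :: ps) -> uniq (p :: ps) ->
  \sum_(1 <= m < M.+1 | sieved (p :: ps) m) f m =
  \sum_(1 <= m < M.+1 | sieved ps m) f m
  - \sum_(1 <= m < (M %/ p).+1 | sieved ps m) f (p * m)%N.
Proof.
move=> /= /andP [pp pps] /andP [pnotin ups].
rewrite [X in _ = X - _](bigID (fun m => p %| m)%N) /=.
have -> : \sum_(1 <= m < M.+1 | sieved ps m && (p %| m)%N) f m =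
   \sum_(1 <= m < (M %/ p).+1 | sieved ps m) f (p * m)%N.
  under eq_bigl do rewrite andbC.
  rewrite big_mkcondr big_dvdn_nat ?prime_gt0 // [RHS]big_mkcond.
  apply: eq_bigr => m _; congr (if _ then _ else _).
  apply: eq_in_all => q qps; rewrite Euclid_dvdM ?(allP pps) //.
  rewrite dvdn_prime2 //; last exact: (allP pps).
  suff -> : (q == p) = false by [].
  by apply/negP => /eqP E; move: qps; rewrite E (negbTE pnotin).
rewrite addrAC subrr add0r; apply: eq_bigl => m.
by rewrite andbC.
Qed.

(** Legendre's recursion: each prime turns a sum into two of the same kind, the second one
    multiplied by [chi p], hence the factor 2. The second range shrinks to [M %/ p], which is why
    [B] is uniform in [K]. *)
Lemma sieved_char_sum n chi B ps M : dirichlet n chi ->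
  (forall K, `|\sum_(1 <= m < K.+1) chi m| <= B) ->
  all prime ps -> uniq ps ->
  `|\sum_(1 <= m < M.+1 | sieved ps m) chi m| <= B * 2 ^+ size ps.
Proof.
move=> D HB; elim: ps M => [|p ps IH] M.
  by move=> _ _; rewrite mulr1; exact: HB.
move=> Hp Hu; have /= /andP [_ Hp'] := Hp; have /= /andP [_ Hu'] := Hu.
rewrite sieved_cons //= exprS mulrCA mulr2n mulrDl mul1r.
apply: le_trans (ler_normB _ _) _; apply: lerD; first exact: IH.
have -> : \sum_(1 <= m < (M %/ p).+1 | sieved ps m) chi (p * m)%N =
  chi p * \sum_(1 <= m < (M %/ p).+1 | sieved ps m) chi m.
  by rewrite mulr_sumr; apply: eq_bigr => m _; case: D => _ ->.
rewrite normrM; apply: le_trans (IH (M %/ p)%N Hp' Hu').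
by rewrite ler_piMl // (dirichlet_norm_le1 _ D).
Qed.

(** Each prime doubles the error and adds at most 1 for rounding [M / p], whence
    [2 ^+ size ps - 1]. *)
Lemma sieved_count (F : numFieldType) ps M : all prime ps -> uniq ps ->
  `|\sum_(1 <= m < M.+1 | sieved ps m) 1 - M%:R * \prod_(p <- ps) (1 - p%:R^-1)| <=
     2 ^+ size ps - 1 :> F.
Proof.
elim: ps M => [|p ps IH] M.
  move=> _ _; rewrite big_nil mulr1 expr0 subrr /sieved /=.
  by rewrite big_const_nat iter_addr_0 subn1 /= subrr normr0.
move=> Hp Hu; have /= /andP [pp Hp'] := Hp; have /= /andP [_ Hu'] := Hu.
rewrite sieved_cons // big_cons /=.
set P := \prod_(p <- ps) _.
have fac01 q : q \in ps -> 0 <= (1 - q%:R^-1 : F) <= 1.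
  move=> /(allP Hp') qp; have q0 : (0 : F) < q%:R by rewrite ltr0n prime_gt0.
  by rewrite subr_ge0 invf_le1 ?ler1n ?prime_gt0 //= lerBlDr lerDl invr_ge0 ltW.
have P01 : 0 <= P <= 1.
  rewrite /P big_seq; apply/andP; split.
    by apply: prodr_ge0 => q qps; case/andP: (fac01 q qps).
  by apply: prodr_ile1 => q; exact: fac01.
set S1 := \sum_(_ <= m < M.+1 | _) _; set S2 := \sum_(_ <= m < (_ %/ _).+1 | _) _.
have I1 : `|S1 - M%:R * P| <= 2 ^+ size ps - 1 := IH M Hp' Hu'.
have I2 : `|S2 - (M %/ p)%:R * P| <= 2 ^+ size ps - 1 := IH (M %/ p)%N Hp' Hu'.
have p0 : (p%:R : F) != 0 by rewrite pnatr_eq0 -lt0n prime_gt0.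
have I3 : `|M%:R / p%:R * P - (M %/ p)%:R * P| <= 1.
  have -> : M%:R / p%:R = (M %/ p)%:R + (M %% p)%:R / p%:R :> F.
    by rewrite {1}(divn_eq M p) natrD natrM mulrDl mulfK.
  rewrite -mulrBl addrAC subrr add0r.
  rewrite ger0_norm; last by rewrite mulr_ge0 ?divr_ge0 //; case/andP: P01.
  apply: mulr_ile1; rewrite ?divr_ge0 //; try by case/andP: P01.
  by rewrite ler_pdivrMr ?ltr0n ?prime_gt0 // mul1r ler_nat ltnW // ltn_pmod // prime_gt0.
have -> : S1 - S2 - M%:R * ((1 - p%:R^-1) * P) =
  (S1 - M%:R * P) - (S2 - (M %/ p)%:R * P) + (M%:R / p%:R * P - (M %/ p)%:R * P).
  by ring.
apply: le_trans (ler_normD _ _) _.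
have : `|S1 - M%:R * P - (S2 - (M %/ p)%:R * P)| + `|M%:R / p%:R * P - (M %/ p)%:R * P| <=
   (2 ^+ size ps - 1) + (2 ^+ size ps - 1) + 1.
  by apply: lerD I3; apply: le_trans (ler_normB _ _) _; exact: lerD.
move=> H; apply: le_trans H _; rewrite exprS le_eqVlt; apply/orP; left; apply/eqP.
by ring.
Qed.

Lemma totient_prod (F : numFieldType) n : (0 < n)%N ->
  (totient n)%:R = n%:R * \prod_(p <- primes n) (1 - p%:R^-1) :> F.
Proof.
move=> n0; have En : n = (\prod_(p <- primes n) p ^ logn p n)%N.
  by rewrite {1}(prod_prime_decomp n0) prime_decompE big_map.
rewrite totientE // [in X in _ = X%:R * _]En !natr_prod -big_split /=; apply: eq_big_seq => p.
rewrite mem_primes => /and3P [pp _ pn].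
have : (0 < logn p n)%N by rewrite logn_gt0 mem_primes pp n0.
case: (logn p n) => // k _ /=.
have p0 : (p%:R : F) != 0 by rewrite pnatr_eq0 -lt0n prime_gt0.
rewrite natrM !natrX exprS -subn1 natrB ?prime_gt0 //.
by field.
Qed.

Lemma coprime_count_bound (F : numFieldType) n M : (0 < n)%N ->
  `|\sum_(1 <= m < M.+1) (coprime m n)%:R - M%:R * (totient n)%:R / n%:R|
     <= 2 ^+ size (primes n) :> F.
Proof.
move=> n0.
have -> : \sum_(1 <= m < M.+1) (coprime m n)%:R =
    \sum_(1 <= m < M.+1 | sieved (primes n) m) 1 :> F.
  rewrite [RHS]big_mkcond !big_nat; apply: eq_bigr => m /andP [m0 _].
  by rewrite sieved_coprime //; case: coprime.
rewrite totient_prod // -mulrA [n%:R * _]mulrC mulfK ?pnatr_eq0 -?lt0n //.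
have H := @sieved_count F (primes n) M; apply: le_trans (H _ _) _.
- by apply/allP => p; rewrite mem_primes => /and3P[].
- exact: primes_uniq.
by rewrite lerBlDr lerDl.
Qed.

(** * A large sieve inequality *)

(** A matrix and its transpose have the same operator norm. The proof expands the nonnegative sum of
    the [|N * conj (a i) - u i| ^ 2], where [u] is the image of the conjugate of [t]; the hypothesis
    bounds the squared norm of [u] by [N * B]. *)
Lemma duality (J I : finType) (P : pred J) (v : J -> I -> algC) (N : algC) (a : I -> algC) :
  0 < N ->
  (forall c : J -> algC,
     \sum_i `|\sum_(j | P j) c j * v j i| ^+ 2 <= N * \sum_(j | P j) `|c j| ^+ 2) ->
  \sum_(j | P j) `|\sum_i a i * v j i| ^+ 2 <= N * \sum_i `|a i| ^+ 2.
Proof.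
move=> N0 H.
set B := \sum_(j | P j) _; set A := \sum_i `|a i| ^+ 2.
pose t j := \sum_i a i * v j i.
pose u i := \sum_(j | P j) (t j)^* * v j i.
have HB : B = \sum_i a i * u i.
  under [RHS]eq_bigr do rewrite mulr_sumr.
  rewrite exchange_big /=; apply: eq_bigr => j _.
  rewrite normCK -/(t j) mulrC /t mulr_sumr; apply: eq_bigr => i _.
  by rewrite mulrCA.
have B0 : 0 <= B by apply: sumr_ge0 => j _; exact: exprn_ge0.
have HU : \sum_i `|u i| ^+ 2 <= N * B.
  by apply: le_trans (H _) _; under eq_bigr do rewrite norm_conjC.
have : 0 <= \sum_i `|N * (a i)^* - u i| ^+ 2.
  by apply: sumr_ge0 => i _; exact: exprn_ge0.
have Nr : N^* = N by apply/CrealP; exact: gtr0_real.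
have -> : \sum_i `|N * (a i)^* - u i| ^+ 2 =
    N ^+ 2 * A - N * B - N * B^* + \sum_i `|u i| ^+ 2.
  rewrite HB rmorph_sum /= !mulr_sumr -!sumrN -!big_split /=; apply: eq_bigr => i _.
  by rewrite !normCK rmorphB !rmorphM /= Nr conjCK; ring.
have -> : B^* = B by apply/CrealP; exact: ger0_real.
move=> H0; rewrite -(ler_pM2l N0).
have : N ^+ 2 * A - N * B - N * B + \sum_i `|u i| ^+ 2 <= N ^+ 2 * A - N * B.
  rewrite -subr_ge0; set U := \sum_i _ in HU *.
  have -> : N ^+ 2 * A - N * B - (N ^+ 2 * A - N * B - N * B + U) = N * B - U by ring.
  by rewrite subr_ge0.
move=> /(le_trans H0); rewrite subr_ge0 => H1; apply: le_trans H1 _.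
by rewrite mulrA -expr2.
Qed.

Lemma sum_sqr_gram (J I : finType) (P : pred J) (c : J -> algC) (v : J -> I -> algC) :
  \sum_i `|\sum_(j | P j) c j * v j i| ^+ 2 =
  \sum_(j | P j) \sum_(j' | P j') c j * (c j')^* * \sum_i v j i * (v j' i)^*.
Proof.
under eq_bigr do rewrite normCK rmorph_sum /= mulr_suml.
rewrite exchange_big /=; apply: eq_bigr => j _.
under eq_bigr do rewrite mulr_sumr.
rewrite exchange_big /=; apply: eq_bigr => j' _.
by rewrite mulr_sumr; apply: eq_bigr => i _; rewrite rmorphM /=; ring.
Qed.

Lemma real_sum_CS (J : finType) (P : pred J) (x y : J -> algC) :
  (forall j, x j \is Num.real) -> (forall j, y j \is Num.real) ->
  (\sum_(j | P j) x j * y j) ^+ 2 <=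
  (\sum_(j | P j) x j ^+ 2) * (\sum_(j | P j) y j ^+ 2).
Proof.
move=> xr yr.
have E1 : (\sum_(j | P j) x j * y j) ^+ 2 =
    \sum_(i | P i) \sum_(j | P j) (x i * y j) * (x j * y i).
  rewrite expr2 mulr_suml; apply: eq_bigr => i _; rewrite mulr_sumr.
  by apply: eq_bigr => j _; ring.
have E2 : (\sum_(j | P j) x j ^+ 2) * (\sum_(j | P j) y j ^+ 2) =
    \sum_(i | P i) \sum_(j | P j) (x i * y j) ^+ 2.
  rewrite mulr_suml; apply: eq_bigr => i _; rewrite mulr_sumr.
  by apply: eq_bigr => j _; rewrite exprMn.
have E3 : (\sum_(j | P j) x j ^+ 2) * (\sum_(j | P j) y j ^+ 2) =
    \sum_(i | P i) \sum_(j | P j) (x j * y i) ^+ 2.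
  by rewrite E2 exchange_big.
rewrite -(ler_pM2l (ltr0n _ 2)) mulr_natl mulr_natl mulr2n mulr2n {1}E1 {1}E1 {1}E2 E3.
rewrite -!big_split /=; apply: ler_sum => i _; rewrite -!big_split /=; apply: ler_sum => j _.
rewrite -subr_ge0.
have -> : (x i * y j) ^+ 2 + (x j * y i) ^+ 2 - (x i * y j * (x j * y i) + x i * y j * (x j * y i))
  = (x i * y j - x j * y i) ^+ 2 by ring.
by rewrite -realEsqr rpredB ?rpredM.
Qed.

Lemma primitive_separate d psi d' psi' : primitive d psi -> primitive d' psi' ->
  ~ (d = d' /\ psi =1 psi') ->
  exists2 g, coprime g (d * d') & psi g * (psi' g)^* != 1.
Proof.
move=> Hp Hp' ne; apply: contrapT => H; apply: ne.
apply: primitive_unique => // a ad ad'.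
have [[_ _ _ N' _] _] := Hp'.
case: (eqVneq (psi a * (psi' a)^*) 1) => [E|E]; last first.
  by case: H; exists a => //; rewrite coprimeMr ad.
have := congr1 (fun z => z * psi' a) E.
by rewrite /= mul1r -mulrA [_^* * _]mulrC -normCK N' // expr1n mulr1.
Qed.

(** One character times the conjugate of the other is nonprincipal modulo [d * d'], so its partial
    sums are at most [d * d']. The moduli [n], [n'] enter only through their prime divisors, by
    sieving. *)
Lemma gram_entry d psi n d' psi' n' M : primitive d psi -> primitive d' psi' ->
  (0 < n)%N -> (0 < n')%N -> ~ (d = d' /\ psi =1 psi') ->
  `|\sum_(1 <= m < M.+1) (psi m * (coprime m n)%:R) * (psi' m * (coprime m n')%:R)^*| <=
  ((d * 2 ^ size (primes n)) * (d' * 2 ^ size (primes n')))%:R.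
Proof.
move=> Hp Hp' n0 n0' ne; have [g gd g1] := primitive_separate Hp Hp' ne.
have D := dirichlet_mul_conj (proj1 Hp) (proj1 Hp').
set ps := undup (primes n ++ primes n').
have -> : \sum_(1 <= m < M.+1) (psi m * (coprime m n)%:R) * (psi' m * (coprime m n')%:R)^* =
   \sum_(1 <= m < M.+1 | sieved ps m) psi m * (psi' m)^*.
  rewrite [RHS]big_mkcond [LHS]big_nat [RHS]big_nat; apply: eq_bigr => m /andP [m0 _].
  have -> : sieved ps m = coprime m n && coprime m n'.
    rewrite -(sieved_coprime n0 m0) -(sieved_coprime n0' m0) /sieved -all_cat.
    by apply: eq_all_r => p; rewrite mem_undup.
  case: coprime; case: coprime; rewrite /= ?rmorphM ?rmorph0 ?rmorph1 /= ?mulr0 ?mul0r ?mulr1 //.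
have Hps : all prime ps.
  by apply/allP => p; rewrite mem_undup mem_cat !mem_primes => /orP [] /and3P[].
have Hb K := dirichlet_sum_bound K D gd g1.
apply: le_trans (sieved_char_sum M D Hb Hps (undup_uniq _)) _.
rewrite mulnACA [leRHS]natrM; apply: ler_wpM2l => //.
rewrite -natrX ler_nat -expnD leq_exp2l //.
by apply: leq_trans (size_undup _) _; rewrite size_cat.
Qed.

(* A finite family of characters [psi j * 1_(coprime to n j)] of moduli [n j <= X], given by
   the primitive characters [psi j] of conductors [d j] inducing them. *)
Definition char_system (X : nat) (J : finType) (n d : J -> nat) (psi : J -> nat -> algC) :=
  [/\ forall j, (0 < n j <= X)%N, forall j, (d j %| n j)%N,
      forall j, primitive (d j) (psi j) &
      forall i j, n i = n j -> d i = d j -> psi i =1 psi j -> i = j].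

Definition omega2_sum (X : nat) : nat := (\sum_(1 <= k < X.+1) 4 ^ size (primes k))%N.

(** The characters in a fiber are orthogonal functions on [e] residues, each of squared norm at most
    [e]. The dual inequality is tested on the indicator of the residue 1 (the index 0, as [v] is
    shifted), where every character equals 1, so its left side is their number. *)
Lemma char_system_fiber X (J : finType) n d psi k e : @char_system X J n d psi ->
  (\sum_(j | (n j == k) && (d j == e)) 1 <= e)%N.
Proof.
move=> [nX dn prim inj]; pose S : pred J := fun j => (n j == k) && (d j == e).
rewrite (sum1_card S); case: (pickP S) => [j0 /andP [/eqP n0 /eqP d0]|S0]; last by rewrite eq_card0.
have e0 : (0 < e)%N by rewrite -d0; case: (prim j0) => [[]].
have [e' He'] : exists e', e = e'.+1 by exists e.-1; rewrite prednK.
pose v j (i : 'I_e) : algC := psi j i.+1.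
have ort i j : S i -> S j -> i != j -> \sum_x v i x * (v j x)^* = 0.
  move=> /andP [/eqP ni /eqP di] /andP [/eqP nj /eqP dj] ij.
  have Di := proj1 (prim i); have Dj := proj1 (prim j).
  have [|g gd g1] := primitive_separate (prim i) (prim j).
    move=> [_ E]; case/eqP: ij; apply: inj => //; first by rewrite ni nj.
    by rewrite di dj.
  have [] := (Di, Dj); rewrite di dj => De De'.
  pose chi a := psi i a * (psi j a)^*.
  have ge : coprime g e by move: gd; rewrite di coprimeMr => /andP[].
  have Dchi : dirichlet e chi.
    have [_ M P N Z] := De; have [_ M' P' N' Z'] := De'.
    split => //; rewrite /chi.
    - by move=> a b; rewrite M M' rmorphM mulrACA.
    - by move=> a b ab; rewrite (P a b) ?(P' a b).
    - by move=> a ae; rewrite normrM norm_conjC N // N' // mulr1.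
    - by move=> a ae; rewrite Z // mul0r.
  have S0 := dirichlet_sum_period Dchi ge g1.
  rewrite -(big_mkord xpredT (fun x => chi x.+1)).
  move: S0; rewrite -(big_mkord xpredT chi) => S0.
  have : \sum_(0 <= x < e.+1) chi x = \sum_(0 <= x < e.+1) chi x by [].
  rewrite {1}big_nat_recl // {1}big_nat_recr //= S0 add0r.
  have -> : chi e = chi 0%N by case: Dchi => _ _ P _ _; apply: P; rewrite modnn mod0n.
  by move=> /eqP; rewrite -subr_eq0 addrC addKr => /eqP.
have H := @duality J 'I_e S v e%:R (fun i => (val i == 0%N)%:R).
have /H{H} : (0 : algC) < e%:R by rewrite ltr0n.
have nrm j x : `|v j x| <= 1 by apply: dirichlet_norm_le1; exact: (proj1 (prim j)).
have Hc c : \sum_i `|\sum_(j | S j) c j * v j i| ^+ 2 <= e%:R * \sum_(j | S j) `|c j| ^+ 2.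
  rewrite sum_sqr_gram.
  rewrite mulr_sumr; apply: ler_sum => j Sj.
  rewrite (bigD1 j) //= [X in _ + X]big1; last first.
    by move=> j' /andP [Sj' jj']; rewrite ort ?mulr0 // eq_sym.
  rewrite addr0.
  rewrite -normCK mulrC; apply: ler_wpM2r; first exact: exprn_ge0.
  under eq_bigr do rewrite -normCK.
  apply: (@le_trans _ _ (\sum_(i < e) 1)); last by rewrite sumr_const card_ord.
  by apply: ler_sum => i _; apply: exprn_ile1.
move=> /(_ Hc).
have -> : \sum_(i < e) `|(val i == 0%N)%:R : algC| ^+ 2 = 1.
  rewrite He' big_ord_recl /= normr1 expr1n big1 ?addr0 // => i _.
  by rewrite normr0 expr0n.
have -> : \sum_(j | S j) `|\sum_i (val i == 0%N)%:R * v j i| ^+ 2 = #|S|%:R.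
  rewrite -sum1_card natr_sum; apply: eq_bigr => j Sj.
  have -> : \sum_i (val i == 0%N)%:R * v j i = psi j 1%N.
    rewrite (bigD1 (Ordinal e0)) //= mul1r big1 ?addr0 // => i.
    by rewrite -val_eqE /= => /negbTE ->; rewrite mul0r.
  by rewrite (dirichlet1 (proj1 (prim j))) normr1 expr1n.
by rewrite mulr1 ler_nat.
Qed.

(** For a given modulus there are at most [e] characters of each conductor [e], each weighted by
    [e ^ 2], and fewer than [Q'] is every [e]: this makes [Q' ^ 3] for each of [Q'] conductors. *)
Lemma char_system_energy X (J : finType) n d psi Q' : @char_system X J n d psi ->
  (\sum_(j | d j < Q') (d j * 2 ^ size (primes (n j))) ^ 2 <= Q' ^ 4 * omega2_sum X)%N.
Proof.
move=> H; have [nX dn prim inj] := H.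
have E j : (d j < Q')%N -> ((d j * 2 ^ size (primes (n j))) ^ 2 =
   \sum_(k < X.+1 | 0 < k) \sum_(e < Q') ((n j == k) && (d j == e)) *
     (e ^ 2 * 4 ^ size (primes k)))%N.
  move=> dQ; case/andP: (nX j) => n0; rewrite -ltnS => nX'.
  rewrite (bigD1 (Ordinal nX')) //= (bigD1 (Ordinal dQ)) //= !eqxx mul1n.
  rewrite [X in (_ = _ + X + _)%N]big1 ?addn0; last first.
    by move=> e; rewrite -val_eqE /= eq_sym => /negbTE ->.
  rewrite big1 ?addn0; last first.
    move=> k /andP [_]; rewrite -val_eqE /= eq_sym => /negbTE ->.
    by rewrite big1.
  by rewrite expnMn; congr (_ * _)%N; rewrite -expnM mulnC expnM.
rewrite (eq_bigr _ E) exchange_big /= /omega2_sum big_distrr /= big_geq_mkord /=.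
rewrite [leqRHS](eq_bigl (fun k : 'I_X.+1 => 0 < k)%N) //.
apply: leq_sum => k k0; rewrite exchange_big /=.
apply: (@leq_trans (\sum_(e < Q') Q' ^ 3 * 4 ^ size (primes k))%N); last first.
  by rewrite sum_nat_const card_ord mulnA -expnS.
apply: leq_sum => e _; rewrite -big_distrl /= -big_mkcondr /=.
have F : (\sum_(j | (d j < Q') && ((n j == k) && (d j == e))) 1 <= e)%N.
  apply: leq_trans (char_system_fiber k e H); rewrite [leqRHS]big_mkcond [leqLHS]big_mkcond /=.
  by apply: leq_sum => j _; case: (d j < Q')%N; case: (n j == k); case: (d j == e).
apply: (@leq_trans (e * (e ^ 2 * 4 ^ size (primes k)))%N); first by rewrite leq_mul2r F orbT.
rewrite mulnA -expnS; apply: leq_mul => //; rewrite leq_exp2r //; exact: ltnW.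
Qed.

(** Members induced by one primitive character have distinct moduli, all multiples of [d i]. *)
Lemma char_system_mult X (J : finType) n d psi Q i : @char_system X J n d psi ->
  (0 < Q)%N -> (Q <= d i)%N ->
  (#|[pred j | `[< d i = d j /\ psi i =1 psi j >]]| <= X %/ Q)%N.
Proof.
move=> [nX dn prim inj] Q0 Qd.
have di0 : (0 < d i)%N by apply: leq_trans Qd.
apply: (@leq_trans (X %/ d i)); last exact: leq_div2l.
pose f j : 'I_(X %/ d i).+1 := inord (n j %/ d i).
set S := [pred j | _].
have fj j : S j -> f j = (n j %/ d i)%N :> nat.
  move=> _; rewrite inordK // ltnS leq_div2r //; by case/andP: (nX j).
have finj : {in S &, injective f}.
  move=> j j' /[dup] Sj /asboolP [dj pj] /[dup] Sj' /asboolP [dj' pj'] E.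
  apply: inj; last by move=> a; rewrite -pj -pj'.
    have : f j = f j' :> nat by rewrite E.
    rewrite !fj // => E'; rewrite -(divnK (dn j)) -(divnK (dn j')) -dj -dj'.
    by rewrite E'.
  by rewrite -dj -dj'.
rewrite -(card_in_imset finj).
apply: (@leq_trans #|[set~ (ord0 : 'I_(X %/ d i).+1)]|); last first.
  by rewrite cardsC1 card_ord.
apply: subset_leq_card; apply/fintype.subsetP => y /imsetP [j Sj ->].
rewrite !inE -val_eqE /= fj // -lt0n divn_gt0 //.
move/asboolP: Sj => [-> _]; apply: dvdn_leq (dn j); by case/andP: (nX j).
Qed.

(** In the Gram matrix of the dual form, entries belonging to the same primitive character cost at
    most [M], with at most [X %/ Q] of them in a row; all others are dominated by the rank-one
    matrix [D j * D j'], which Cauchy-Schwarz handles. *)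
Lemma large_sieve X (J : finType) n d psi Q Q' M (a : nat -> algC) :
  @char_system X J n d psi -> (0 < X)%N -> (0 < Q)%N -> (0 < Q')%N ->
  \sum_(j | (Q <= d j < Q')%N)
     `|\sum_(1 <= m < M.+1) a m * (psi j m * (coprime m (n j))%:R)| ^+ 2 <=
  (X %/ Q * M + Q' ^ 4 * omega2_sum X)%:R * \sum_(1 <= m < M.+1) `|a m| ^+ 2.
Proof.
move=> H X0 Q0 Q0'; have [nX dn prim inj] := H.
set P := fun j => (Q <= d j < Q')%N.
pose v j (i : 'I_M) : algC := psi j i.+1 * (coprime i.+1 (n j))%:R.
under eq_bigr do rewrite big_add1 big_mkord.
rewrite big_add1 big_mkord /=.
apply: (@duality J 'I_M P v _ (fun i => a i.+1)).
  rewrite ltr0n addn_gt0; apply/orP; right; rewrite muln_gt0 expn_gt0 Q0' /=.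
  by rewrite /omega2_sum big_ltn.
move=> c.
pose same i j := `[< d i = d j /\ psi i =1 psi j >].
pose D j : algC := (d j * 2 ^ size (primes (n j)))%:R.
have nrm j i : `|v j i| <= 1.
  rewrite /v normrM; apply: mulr_ile1 => //.
    by apply: dirichlet_norm_le1; exact: (proj1 (prim j)).
  by case: coprime; rewrite ?normr1 ?normr0 ?ler01.
have G j j' : `|\sum_i v j i * (v j' i)^*| <= (same j j')%:R * M%:R + D j * D j'.
  have D0 : 0 <= D j * D j' by rewrite mulr_ge0.
  case: (boolP (same j j')) => [_|ne].
    apply: (@le_trans _ _ M%:R); last by rewrite mul1r lerDl.
    apply: le_trans (ler_norm_sum _ _ _) _.
    apply: (@le_trans _ _ (\sum_(i < M) 1)); last by rewrite sumr_const card_ord.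
    by apply: ler_sum => i _; rewrite normrM norm_conjC mulr_ile1.
  rewrite mul0r add0r /D -natrM.
  rewrite -(big_mkord xpredT (fun m => psi j m.+1 * (coprime m.+1 (n j))%:R *
     (psi j' m.+1 * (coprime m.+1 (n j'))%:R)^*)).
  rewrite -(big_add1 _ _ 0 M.+1 xpredT (fun m => psi j m * (coprime m (n j))%:R *
     (psi j' m * (coprime m (n j'))%:R)^*)).
  apply: gram_entry; try exact: prim.
  - by case/andP: (nX j).
  - by case/andP: (nX j').
  - by move=> E; case/negP: ne; apply/asboolP.
apply: (@le_trans _ _ (\sum_(j | P j) \sum_(j' | P j')
    `|c j| * `|c j'| * ((same j j')%:R * M%:R + D j * D j'))).
  have r : \sum_i `|\sum_(j | P j) c j * v j i| ^+ 2 \is Num.real.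
    by apply: ger0_real; apply: sumr_ge0 => i _; exact: exprn_ge0.
  apply: le_trans (real_ler_norm r) _; rewrite sum_sqr_gram.
  apply: le_trans (ler_norm_sum _ _ _) _; apply: ler_sum => j _.
  apply: le_trans (ler_norm_sum _ _ _) _; apply: ler_sum => j' _.
  by rewrite !normrM norm_conjC; apply: ler_wpM2l => //; rewrite mulr_ge0.
under eq_bigr do (under eq_bigr do rewrite mulrDr; rewrite big_split /=).
rewrite big_split /= natrD mulrDl; apply: lerD.
  (* Schur's test: as [same] is symmetric, [2 |c j| |c j'| <= |c j| ^ 2 + |c j'| ^ 2] reduces the
     form to its row sums. *)
  apply: (@le_trans _ _ (\sum_(j | P j) \sum_(j' | P j')
     (same j j')%:R * M%:R * `|c j| ^+ 2)).
    have sym j j' : same j j' = same j' j.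
      by apply/asboolP/asboolP => [] [-> E]; split => // a0; rewrite E.
    set T := leRHS.
    have T2 : T = \sum_(j | P j) \sum_(j' | P j') (same j j')%:R * M%:R * `|c j'| ^+ 2.
      rewrite /T exchange_big /=; apply: eq_bigr => j _; apply: eq_bigr => j' _.
      by rewrite sym.
    rewrite -(ler_pM2l (ltr0n _ 2)) mulr_natl mulr_natl mulr2n mulr2n [X in _ <= X + _]T2 /T.
    rewrite -!big_split /=; apply: ler_sum => j _; rewrite -!big_split /=; apply: ler_sum => j' _.
    rewrite -subr_ge0.
    have -> : (same j j')%:R * M%:R * `|c j'| ^+ 2 + (same j j')%:R * M%:R * `|c j| ^+ 2 -
      (`|c j| * `|c j'| * ((same j j')%:R * M%:R) + `|c j| * `|c j'| * ((same j j')%:R * M%:R)) =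
      (same j j')%:R * M%:R * (`|c j| - `|c j'|) ^+ 2 by ring.
    apply: mulr_ge0; first exact: mulr_ge0.
    by rewrite -realEsqr rpredB ?normr_real.
  rewrite mulr_sumr; apply: ler_sum => j /andP [Qd _].
  rewrite -mulr_suml; apply: ler_wpM2r; first exact: exprn_ge0.
  rewrite -mulr_suml natrM; apply: ler_wpM2r => //.
  rewrite -natr_sum ler_nat.
  apply: leq_trans (char_system_mult H Q0 Qd).
  rewrite -sum1_card big_mkcond [leqRHS]big_mkcond /=; apply: leq_sum => j' _.
  by rewrite inE -/(same j j'); case: (P j'); case: (same j j').
have -> : \sum_(j | P j) \sum_(j' | P j') `|c j| * `|c j'| * (D j * D j') =
   (\sum_(j | P j) D j * `|c j|) ^+ 2.
  rewrite expr2 mulr_suml; apply: eq_bigr => i _; rewrite mulr_sumr.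
  by apply: eq_bigr => j _; ring.
apply: le_trans (real_sum_CS _ _ _) _ => [j|j|]; rewrite ?normr_real ?realn //.
apply: ler_wpM2r; first by apply: sumr_ge0 => j _; exact: exprn_ge0.
apply: (@le_trans _ _ (\sum_(j | d j < Q') (d j * 2 ^ size (primes (n j))) ^ 2)%N%:R); last first.
  by rewrite ler_nat; exact: (char_system_energy Q' H).
rewrite natr_sum big_mkcond [leRHS]big_mkcond /=; apply: ler_sum => j _.
rewrite /P; case: (Q <= d j)%N => /=; last by case: ifP.
by case: ifP => // _; rewrite natrX.
Qed.

(** * Characters trivial on a subgroup *)

Definition residue_submonoid (n : nat) (H : pred nat) : Prop :=
  [/\ H 1%N, (forall a b, H a -> H b -> H (a * b)%N),
      (forall a b, (a = b %[mod n])%N -> H a = H b) & (forall a, H a -> coprime a n)].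

(* The characters are those of the quotient of the unit group by [H]. *)
Lemma dual_characters n H : (0 < n)%N -> residue_submonoid n H ->
  exists (I : finType) (chi : I -> nat -> algC) (i0 : I),
   [/\ forall i, dirichlet n (chi i), forall i j, chi i =1 chi j -> i = j,
       forall a, coprime a n -> chi i0 a = 1 &
       forall a, (H a)%:R * #|I|%:R = \sum_i chi i a].
Proof.
move=> n_gt0 [H1 HM HP Hc].
have [n1|n1] := leqP n 1.
  have n1E : n = 1%N by lia.
  subst n.
  have Ha a : H a by rewrite (HP a 1%N) ?modn1.
  exists unit, (fun _ _ => 1), tt; split => //; last first.
  - by move=> a; rewrite Ha mul1r sumr_const.
  - by move=> [] [].
  move=> _; split=> // [a b|a|a]; rewrite ?mulr1 ?normr1 //.
  by rewrite coprimen1.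
pose HS := [set u : {unit 'Z_n} | H (FinRing.uval u : 'Z_n)].
have gHS : group_set HS.
  apply/group_setP; split; first by rewrite inE /= Zp_cast // modn_small.
  move=> u v; rewrite !inE => Hu Hv /=.
  have := HM _ _ Hu Hv; rewrite (HP _ ((FinRing.uval u : nat) * FinRing.uval v %% n)%N) ?modn_mod //.
  by rewrite -[X in (_ %% X)%N](Zp_cast n1).
pose HG := Group gHS.
pose u (a : nat) : {unit 'Z_n} := insubd (1%g : {unit 'Z_n}) (a%:R : 'Z_n).
have uE a : coprime a n -> FinRing.uval (u a) = a%:R :> 'Z_n.
  move=> an; have /= := val_insubd (1%g : {unit 'Z_n}) (a%:R : 'Z_n).
  by rewrite unitZpE // coprime_sym an.
have uN a : coprime a n -> (FinRing.uval (u a) : nat) = (a %% n)%N.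
  by move=> an; rewrite uE // val_Zp_nat.
have cu (x : {unit 'Z_n}) : coprime (FinRing.uval x : 'Z_n) n.
  by rewrite coprime_sym -unitZpE // natr_Zp; exact: (valP x).
have uK (x : {unit 'Z_n}) : u (FinRing.uval x : 'Z_n) = x.
  by apply: val_inj; rewrite /= uE // natr_Zp.
have uM a b : coprime a n -> coprime b n -> u (a * b)%N = (u a * u b)%g.
  by move=> an bn; apply: val_inj; rewrite /= !uE ?coprimeMl ?an // natrM.
have uH a : coprime a n -> (u a \in HG) = H a.
  by move=> an; rewrite inE uN //; apply: HP; rewrite modn_mod.
have abG : abelian [set: {unit 'Z_n}] by exact: units_Zp_abelian.
have nH (x : {unit 'Z_n}) : x \in 'N(HG)%g.
  have /fintype.subsetP := sub_abelian_norm abG (finset.subsetT HG).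
  by apply; rewrite inE.
pose Q := ([set: {unit 'Z_n}] / HG)%G.
have abQ : abelian Q by exact: quotient_abelian.
have lin (i : Iirr Q) : 'chi_i \is a linear_char by apply/char_abelianP.
have cQ (x : {unit 'Z_n}) : coset HG x \in Q by apply: mem_quotient; rewrite inE.
exists (Iirr Q), (fun i a => if coprime a n then 'chi_i (coset HG (u a)) else 0), 0.
split.
- move=> i; split => //.
  + move=> a b; rewrite coprimeMl; case: (boolP (coprime a n)) => an /=; last by rewrite mul0r.
    case: (boolP (coprime b n)) => bn /=; last by rewrite mulr0.
    by rewrite uM // morphM ?nH // lin_charM ?cQ ?lin.
  + move=> a b ab; rewrite (coprime_congr ab); case: ifP => // bn; congr ('chi_i (coset _ _)).
    apply: val_inj; rewrite /= !uE // ?(coprime_congr ab) //; apply: val_inj.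
    by rewrite /= !val_Zp_nat.
  + by move=> a ->; rewrite normC_lin_char ?cQ ?lin.
  + by move=> a /negbTE ->.
- move=> i j E; apply: irr_inj; apply/cfun_inP => y /morphimP [x Nx _ ->].
  by have := E (FinRing.uval x : 'Z_n); rewrite cu uK.
- by move=> a ->; rewrite irr0 cfun1E cQ.
move=> a; case: (boolP (coprime a n)) => an; last first.
  rewrite big1 //; have -> : H a = false by apply: contraNF an; exact: Hc.
  by rewrite mul0r.
have chi1 (i : Iirr Q) : 'chi_i 1%g = 1 by exact: lin_char1.
have [Ha|Ha] := boolP (H a).
  rewrite coset_id ?uH // mul1r; under eq_bigr do rewrite chi1.
  by rewrite sumr_const.
rewrite mul0r; have := congr1 (fun phi : 'CF(Q) => phi (coset HG (u a))) (cfReg_sum Q).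
rewrite /= cfRegE sum_cfunE.
under [X in _ = X -> _]eq_bigr do rewrite cfunE chi1 mul1r.
move=> <-; case: eqP => // E; case/negP: Ha; rewrite -uH //.
exact: coset_idr (nH _) E.
Qed.

(** * Moments of character sums *)

Definition rep_count (r Y m : nat) : nat :=
  #|[set f : {ffun 'I_r -> 'I_Y} | (\prod_i (f i).+1)%N == m]|.

Definition energy (r Y : nat) : nat :=
  #|[set fg : {ffun 'I_r -> 'I_Y} * {ffun 'I_r -> 'I_Y} |
     (\prod_i (fg.1 i).+1)%N == (\prod_i (fg.2 i).+1)%N]|.

Lemma prod_ffun_bounds r Y (f : {ffun 'I_r -> 'I_Y}) :
  (0 < \prod_i (f i).+1 < (Y ^ r).+1)%N.
Proof.
apply/andP; split; first by apply: prodn_gt0.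
rewrite ltnS -[X in (_ <= Y ^ X)%N]card_ord -prod_nat_const; apply: leq_prod => i _; exact: ltn_ord.
Qed.

Lemma char_sum_pow (chi : nat -> algC) r Y :
  (forall a b, chi (a * b)%N = chi a * chi b) -> chi 1%N = 1 ->
  (\sum_(1 <= a < Y.+1) chi a) ^+ r =
  \sum_(1 <= m < (Y ^ r).+1) (rep_count r Y m)%:R * chi m.
Proof.
move=> chiM chi1.
have chi_prod (f : {ffun 'I_r -> 'I_Y}) : \prod_i chi (f i).+1 = chi (\prod_i (f i).+1)%N.
  by rewrite (big_morph chi chiM chi1).
have -> : (\sum_(1 <= a < Y.+1) chi a) ^+ r =
    \sum_(f : {ffun 'I_r -> 'I_Y}) chi (\prod_i (f i).+1)%N.
  rewrite big_add1 big_mkord -[r in _ ^+ r]card_ord -prodr_const.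
  by rewrite bigA_distr_bigA /=; apply: eq_bigr => f _.
rewrite big_geq_mkord /=.
rewrite (partition_big (fun f : {ffun 'I_r -> 'I_Y} =>
   Ordinal (proj2 (andP (prod_ffun_bounds f)))) (fun m : 'I_(Y ^ r).+1 => 0 < m)%N) /=; last first.
  by move=> f _; case/andP: (prod_ffun_bounds f).
apply: eq_bigr => m m0; rewrite /rep_count -sum1_card natr_sum mulr_suml.
apply: eq_big => f; first by rewrite inE -val_eqE.
by rewrite mul1r => /eqP <-.
Qed.

Lemma energyE r Y : energy r Y = (\sum_(1 <= m < (Y ^ r).+1) rep_count r Y m ^ 2)%N.
Proof.
pose F (f : {ffun 'I_r -> 'I_Y}) := (\prod_i (f i).+1)%N.
rewrite /energy -sum1_card big_geq_mkord /=.
rewrite (partition_big (fun fg : {ffun 'I_r -> 'I_Y} * {ffun 'I_r -> 'I_Y} =>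
   Ordinal (proj2 (andP (prod_ffun_bounds fg.1)))) (fun m : 'I_(Y ^ r).+1 => 0 < m)%N) /=; last first.
  by move=> f _; case/andP: (prod_ffun_bounds f.1).
apply: eq_bigr => m m0; rewrite sum1_card /rep_count -mulnn -cardsX.
apply: eq_card => [] [f g]; rewrite [LHS]unfold_in /= !inE /= -val_eqE /=.
by rewrite andbC; case: eqVneq => //= <-; rewrite eq_sym.
Qed.

(* Replaces Hoelder's inequality: with [b] about the expected size of [u], only the [k.+1]-st moment of [u] matters. *)
Lemma le_add_pow (u b : algC) k : 0 <= u -> 0 < b -> u <= b + u ^+ k.+1 / b ^+ k.
Proof.
move=> u0 b0; have ur := ger0_real u0; have br := gtr0_real b0.
have bk : 0 < b ^+ k by exact: exprn_gt0.
case: (real_leP ur br) => H.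
  by apply: le_trans H _; rewrite lerDl divr_ge0 ?exprn_ge0 // ltW.
apply: (@le_trans _ _ (u ^+ k.+1 / b ^+ k)); last by rewrite lerDr ltW.
rewrite ler_pdivlMr // exprS; apply: ler_wpM2l => //.
by apply: lerXn2r; rewrite ?nnegrE //; exact: ltW.
Qed.

(** The [r]-th power of a character sum is a sum of length [Y ^ r] whose coefficients have square
    sum [energy r Y], and the large sieve applies to it. In [le_add_pow] the term [b] is paid with
    the total weight, at most [X], and the moment term costs as much again: hence the factor 2. *)
Lemma level_bound X (J : finType) n d psi (w : J -> algC) Q Q' r Y b :
  @char_system X J n d psi -> (0 < X)%N -> (0 < Q)%N -> (0 < Q')%N -> (0 < r)%N -> (0 < b)%N ->
  (forall j, 0 <= w j <= 1) -> \sum_j w j <= X%:R ->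
  ((X %/ Q * Y ^ r + Q' ^ 4 * omega2_sum X) * energy r Y <= X * b ^ (2 * r))%N ->
  \sum_(j | (Q <= d j < Q')%N)
     w j * `|\sum_(1 <= a < Y.+1) psi j a * (coprime a (n j))%:R| <= (2 * X * b)%:R.
Proof.
move=> H X0 Q0 Q0' r0 b0 w01 sw cond.
have b0' : (0 : algC) < b%:R by rewrite ltr0n.
set S := fun j => \sum_(1 <= a < Y.+1) psi j a * (coprime a (n j))%:R.
have LS := @large_sieve X J n d psi Q Q' (Y ^ r) (fun m => (rep_count r Y m)%:R) H X0 Q0 Q0'.
have SE j : `|S j| ^+ (2 * r) = `|\sum_(1 <= m < (Y ^ r).+1)
    (rep_count r Y m)%:R * (psi j m * (coprime m (n j))%:R)| ^+ 2.
  have D : dirichlet (d j) (psi j) by case: H => _ _ /(_ j) [].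
  rewrite -(@char_sum_pow (fun m => psi j m * (coprime m (n j))%:R)).
  - by rewrite normrX -exprM mulnC.
  - move=> a c; case: D => _ -> _ _ _; rewrite coprimeMl; case: coprime; case: coprime => /=.
    + by rewrite !mulr1.
    + by rewrite !mulr0.
    + by rewrite !mulr0 mul0r.
    + by rewrite !mulr0.
  - by rewrite (dirichlet1 D) coprime1n mulr1.
have Sb : \sum_(j | (Q <= d j < Q')%N) `|S j| ^+ (2 * r) <= (X * b ^ (2 * r))%:R.
  under eq_bigr do rewrite SE.
  apply: le_trans LS _.
  apply: le_trans (_ : _ <= ((X %/ Q * Y ^ r + Q' ^ 4 * omega2_sum X) * energy r Y)%:R) _.
    rewrite natrM energyE natr_sum; apply: ler_wpM2l => //; apply: ler_sum => m _.
    by rewrite normr_nat natrX.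
  by rewrite ler_nat.
have [k Hk] : exists k, (2 * r)%N = k.+1 by exists (2 * r).-1; rewrite prednK // muln_gt0.
apply: (@le_trans _ _ (\sum_(j | (Q <= d j < Q')%N) (w j * b%:R + `|S j| ^+ (2 * r) / b%:R ^+ k))).
  apply: ler_sum => j _; case/andP: (w01 j) => w0 w1.
  apply: le_trans (ler_wpM2l w0 (le_add_pow k (normr_ge0 (S j)) b0')) _.
  rewrite mulrDr lerD2l Hk ler_piMl // divr_ge0 ?exprn_ge0 //.
rewrite big_split /= -mulr_suml -mulr_suml.
have -> : (2 * X * b)%:R = X%:R * b%:R + X%:R * b%:R :> algC.
  by rewrite -mulnA mul2n -addnn natrD natrM.
apply: lerD.
  rewrite ler_pM2r //; apply: le_trans sw; rewrite big_mkcond /=; apply: ler_sum => j _.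
  by case: ifP => // _; case/andP: (w01 j).
rewrite ler_pdivrMr ?exprn_gt0 //; apply: le_trans Sb _.
by rewrite Hk natrM natrX exprS mulrA.
Qed.

(** * Deviation of the counting function of a subgroup *)

(** The characters trivial on [H], each represented by the primitive character inducing it, because
    the large sieve sees conductors; the factor [(coprime a n)%:R] restores the modulus. *)
Record dual_data (n : nat) (H : pred nat) := DualData {
  dI : finType;
  dcond : dI -> nat;
  dpsi : dI -> nat -> algC;
  dtriv : dI;
  dprim : forall i, primitive (dcond i) (dpsi i);
  ddvd : forall i, (dcond i %| n)%N;
  dinj : forall i j, dcond i = dcond j -> dpsi i =1 dpsi j -> i = j;
  dchar : forall i, dirichlet n (fun a => dpsi i a * (coprime a n)%:R);
  dtriv1 : forall a, coprime a n -> dpsi dtriv a = 1;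
  dnontriv : forall i, i != dtriv -> exists2 g, coprime g n & dpsi i g != 1;
  dsum : forall a, (H a)%:R * #|dI|%:R = \sum_i dpsi i a * (coprime a n)%:R }.

Lemma dual_data_exists n H : (0 < n)%N -> residue_submonoid n H ->
  exists D : dual_data n H, True.
Proof.
move=> n0 /(dual_characters n0) [I [chi [i0 [Dchi inj triv sumE]]]].
have /boolp.choice [f Hf] : forall i, exists p : nat * (nat -> algC),
    [/\ primitive p.1 p.2, (p.1 %| n)%N & forall a, chi i a = p.2 a * (coprime a n)%:R].
  by move=> i; have [d [psi Hd]] := primitive_exists (Dchi i); exists (d, psi).
have chiE i a : chi i a = (f i).2 a * (coprime a n)%:R by case: (Hf i).
unshelve eexists (@DualData n H I (fun i => (f i).1) (fun i => (f i).2) i0 _ _ _ _ _ _ _) => //.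
- by move=> i; case: (Hf i).
- by move=> i; case: (Hf i).
- by move=> i j _ E; apply: inj => a; rewrite !chiE E.
- by move=> i; have := Dchi i; have /funext -> := chiE i.
- by move=> a an; have := triv a an; rewrite chiE an mulr1.
- move=> i ne; apply: contrapT => HH; case/eqP: ne; apply: inj => a.
  case: (boolP (coprime a n)) => an; last first.
    by case: (Dchi i) => _ _ _ _ ->; case: (Dchi i0) => // _ _ _ _ ->.
  rewrite triv // chiE an mulr1; case: (eqVneq ((f i).2 a) 1) => // E.
  by case: HH; exists a.
- by move=> a; rewrite sumE; apply: eq_bigr => i _; rewrite chiE.
Qed.

Definition hits (H : pred nat) (Y : nat) : nat := (\sum_(1 <= a < Y.+1) H a)%N.
Definition residues (n : nat) (H : pred nat) : nat := (\sum_(a < n) H a)%N.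

(** Summing [dsum] over one period leaves only the trivial character. *)
Lemma dual_card n H (D : dual_data n H) : (residues n H * #|dI D| = totient n)%N.
Proof.
have n0 : (0 < n)%N by case: (dchar (dtriv D)).
apply/eqP; rewrite -(eqr_nat algC) natrM /residues natr_sum mulr_suml.
under eq_bigr do rewrite dsum.
rewrite exchange_big /= (bigD1 (dtriv D)) //= [X in _ + X]big1; last first.
  move=> i /dnontriv [g gn g1].
  by apply: (dirichlet_sum_period (dchar i) gn); rewrite gn mulr1.
rewrite addr0 totient_count_coprime natr_sum big_mkord; apply/eqP/eq_bigr => a _.
case: (boolP (coprime a n)) => an; rewrite coprime_sym ?an ?(negbTE an) ?mulr0 //.
by rewrite dtriv1 // mulr1.
Qed.

Lemma dual_hits n H (D : dual_data n H) Y :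
  (hits H Y)%:R * #|dI D|%:R =
  \sum_i \sum_(1 <= a < Y.+1) dpsi (d := D) i a * (coprime a n)%:R :> algC.
Proof.
rewrite exchange_big /= /hits natr_sum mulr_suml.
by apply: eq_bigr => a _; rewrite dsum.
Qed.

Lemma dual_small n H (D : dual_data n H) Y i : i != dtriv D ->
  `|\sum_(1 <= a < Y.+1) dpsi i a * (coprime a n)%:R| <=
  (dcond i * 2 ^ size (primes n))%:R.
Proof.
move=> /dnontriv [g gn g1]; have n0 : (0 < n)%N by case: (dchar i).
have Di := proj1 (dprim i).
have gd : coprime g (dcond i) by exact: coprime_dvdr (ddvd i) gn.
have -> : \sum_(1 <= a < Y.+1) dpsi i a * (coprime a n)%:R =
   \sum_(1 <= a < Y.+1 | sieved (primes n) a) dpsi i a.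
  rewrite [RHS]big_mkcond [LHS]big_nat [RHS]big_nat; apply: eq_bigr => m /andP [m0 _].
  by rewrite sieved_coprime //; case: coprime; rewrite ?mulr1 ?mulr0.
rewrite natrM natrX; apply: (sieved_char_sum Y Di).
- by move=> K; exact: dirichlet_sum_bound Di gd g1.
- by apply/allP => p; rewrite mem_primes => /and3P[].
- exact: primes_uniq.
Qed.

(** The trivial character gives the main term up to [2 ^ omega(n)]. The other characters of
    conductor below [z] contribute at most [z * 2 ^ omega(n)] each, and the mean over the dual
    absorbs their number. *)
Lemma dual_deviation n H (D : dual_data n H) Y z :
  `|(hits H Y)%:R - Y%:R * (residues n H)%:R / n%:R| <=
  ((z + 1) * 2 ^ size (primes n))%:R +
  \sum_(i | (z <= dcond (d := D) i)%N)
     #|dI D|%:R^-1 * `|\sum_(1 <= a < Y.+1) dpsi i a * (coprime a n)%:R| :> algC.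
Proof.
have n0 : (0 < n)%N by case: (dchar (dtriv D)).
have s0 : (0 < #|dI D|)%N by apply/card_gt0P; exists (dtriv D).
have s0' : (0 : algC) < #|dI D|%:R by rewrite ltr0n.
set S := fun i => \sum_(1 <= a < Y.+1) dpsi (d := D) i a * (coprime a n)%:R.
set s : algC := #|dI D|%:R.
have w1 : s^-1 <= 1 by rewrite invf_le1 // ler1n.
have E : (hits H Y)%:R - Y%:R * (residues n H)%:R / n%:R =
  s^-1 * ((S (dtriv D) - Y%:R * (totient n)%:R / n%:R) + \sum_(i | i != dtriv D) S i).
  have := dual_hits D Y; rewrite -/s (bigD1 (dtriv D)) //= => /(congr1 (fun x => s^-1 * x)).
  rewrite mulrC mulfK ?gt_eqF // => ->.
  rewrite -(dual_card D) natrM -/s.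
  have sn0 : s != 0 by rewrite gt_eqF.
  have nn0 : (n%:R : algC) != 0 by rewrite pnatr_eq0 -lt0n.
  by rewrite -/(S (dtriv D)); field; rewrite nn0.
rewrite E normrM gtr0_norm ?invr_gt0 //.
have B1 : `|S (dtriv D) - Y%:R * (totient n)%:R / n%:R| <= 2 ^+ size (primes n).
  have -> : S (dtriv D) = \sum_(1 <= m < Y.+1) (coprime m n)%:R.
    apply: eq_bigr => m _; case: (boolP (coprime m n)) => mn; last by rewrite mulr0.
    by rewrite dtriv1 // mulr1.
  exact: coprime_count_bound.
have B2 : `|\sum_(i | i != dtriv D) S i| <=
   s * (z * 2 ^ size (primes n))%:R + \sum_(i | (z <= dcond (d := D) i)%N) `|S i|.
  apply: le_trans (ler_norm_sum _ _ _) _.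
  apply: (@le_trans _ _ (\sum_(i : dI D) ((z * 2 ^ size (primes n))%:R +
      (if (z <= dcond i)%N then `|S i| else 0)))); last first.
    by rewrite big_split /= sumr_const mulr_natl -/s -big_mkcond /= /s.
  rewrite big_mkcond /=; apply: ler_sum => i _; case: ifP => ne; last first.
    by apply: addr_ge0 => //; case: ifP.
  case: leqP => zd; first by rewrite lerDr.
  rewrite addr0; apply: le_trans (dual_small Y ne) _.
  by rewrite ler_nat leq_mul2r ltnW ?orbT.
have s1 : 0 <= s^-1 by rewrite invr_ge0 ltW.
apply: le_trans (ler_wpM2l s1 (ler_normD _ _)) _.
rewrite mulrDr -mulr_sumr -/S.
apply: le_trans (lerD (ler_wpM2l s1 B1) (ler_wpM2l s1 B2)) _.
rewrite mulrDr mulKf ?gt_eqF // addrA lerD2r mulnDl mul1n natrD addrC lerD2l natrX.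
by rewrite ler_piMl // exprn_ge0.
Qed.

(** The dual characters of all moduli form a single [char_system]. The weights [w], inverse orders
    of the duals, add up to 1 over each modulus and so to [X] in total, as [level_bound] requires.
    The levels [1, ..., R] exhaust the conductors from [z] to [X]. *)
Lemma family_deviation X Y z b R (H : nat -> pred nat) :
  (0 < X)%N -> (1 < z)%N -> (0 < b)%N -> (X < z ^ R.+1)%N ->
  (forall n, (0 < n <= X)%N -> residue_submonoid n (H n)) ->
  (forall r, (0 < r <= R)%N ->
    ((X %/ z ^ r * Y ^ r + (z ^ r.+1) ^ 4 * omega2_sum X) * energy r Y <= X * b ^ (2 * r))%N) ->
  \sum_(1 <= n < X.+1) `|(hits (H n) Y)%:R - Y%:R * (residues n (H n))%:R / n%:R| <=
  ((z + 1) * omega2_sum X + 2 * X * b * R)%:R :> algC.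
Proof.
move=> X0 z1 b0 XR Hsub cond.
have ex (k : 'I_X) : exists D : dual_data k.+1 (H k.+1), True.
  by apply: dual_data_exists => //; apply: Hsub; rewrite ltn_ord.
pose D k := projT1 (cid (ex k)).
pose J : finType := {k : 'I_X & dI (D k)}.
pose nJ (j : J) := (tag j).+1.
pose dJ (j : J) := dcond (tagged j).
pose psiJ (j : J) := dpsi (tagged j).
have sys : char_system X nJ dJ psiJ.
  split.
  - by move=> j; rewrite /nJ /= ltn_ord.
  - by move=> j; exact: ddvd.
  - by move=> j; exact: dprim.
  move=> [k i] [l j] /= [] kl; have {}kl : k = l by apply: val_inj.
  by subst l => dij pij; congr (Tagged _ _); exact: dinj.
pose w (j : J) : algC := #|dI (D (tag j))|%:R^-1.
have card0 k : (0 < #|dI (D k)|)%N by apply/card_gt0P; exists (dtriv (D k)).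
have w01 j : 0 <= w j <= 1.
  by rewrite /w invr_ge0 ler0n /= invf_le1 ?ltr0n ?ler1n.
have sumJ (F : forall k, dI (D k) -> algC) :
    \sum_k \sum_(i : dI (D k)) F k i = \sum_(j : J) F (tag j) (tagged j).
  by rewrite sig_big_dep.
have sw : \sum_j w j <= X%:R.
  rewrite -(sumJ (fun k _ => #|dI (D k)|%:R^-1)).
  rewrite (eq_bigr (fun=> 1)); first by rewrite sumr_const card_ord.
  by move=> k _; rewrite sumr_const -[LHS]mulr_natl mulfV // pnatr_eq0 -lt0n.
pose S (j : J) := `|\sum_(1 <= a < Y.+1) psiJ j a * (coprime a (nJ j))%:R|.
have S0 j : 0 <= w j * S j by rewrite mulr_ge0 ?normr_ge0 //; case/andP: (w01 j).
have lev : \sum_(j | (z <= dJ j)%N) w j * S j <= (2 * X * b * R)%:R.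
  apply: (@le_trans _ _ (\sum_(r < R) \sum_(j | (z ^ r.+1 <= dJ j < z ^ r.+2)%N) w j * S j)).
    under [leRHS]eq_bigr do rewrite big_mkcond.
    rewrite exchange_big big_mkcond /=; apply: ler_sum => j _; case: ifP => zd; last first.
      by apply: sumr_ge0 => r _; case: ifP.
    have d0 : (0 < dJ j)%N by apply: leq_trans zd; exact: ltnW.
    have dX : (dJ j <= X)%N.
      by apply: leq_trans (dvdn_leq _ (ddvd (tagged j))) _ => //; rewrite ltn_ord.
    pose q := trunc_log z (dJ j).
    have [q1 q2] : (z ^ q <= dJ j)%N /\ (dJ j < z ^ q.+1)%N.
      by have /andP[] := trunc_log_bounds z1 d0.
    have q0 : (0 < q)%N by rewrite trunc_log_gt0 z1 /= prednK ?zd // ltnW.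
    have qR : (q.-1 < R)%N.
      rewrite prednK // leqNgt; apply/negP => Rq.
      have : (X < X)%N; last by rewrite ltnn.
      apply: leq_trans XR _; apply: leq_trans _ dX; apply: leq_trans q1.
      by rewrite leq_exp2l.
    rewrite (bigD1 (Ordinal qR)) //= prednK // q1 q2 /= lerDl.
    by apply: sumr_ge0 => r _; case: ifP => // _; exact: S0.
  apply: (@le_trans _ _ (\sum_(r < R) (2 * X * b)%:R)); last first.
    by rewrite sumr_const card_ord [leRHS]natrM mulr_natr.
  apply: ler_sum => r _; apply: (@level_bound X J nJ dJ psiJ w _ _ r.+1) => //.
  - by rewrite expn_gt0 ltnW.
  - by rewrite expn_gt0 ltnW.
  - by apply: cond; rewrite ltn_ord.
rewrite big_add1 big_mkord.
apply: (@le_trans _ _ (\sum_(k < X) (((z + 1) * 2 ^ size (primes k.+1))%:R +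
   \sum_(i | (z <= dcond (d := D k) i)%N) #|dI (D k)|%:R^-1 *
      `|\sum_(1 <= a < Y.+1) dpsi i a * (coprime a k.+1)%:R|))).
  by apply: ler_sum => k _; exact: (dual_deviation (D k) Y z).
rewrite big_split /= natrD; apply: lerD.
  rewrite -natr_sum ler_nat -big_distrr leq_mul2l /= /omega2_sum big_add1 big_mkord.
  by apply/orP; right; apply: leq_sum => k _; rewrite -[4%N]/(2 ^ 2)%N -expnM leq_exp2l // leq_pmull.
apply: le_trans lev; under eq_bigr do rewrite big_mkcond.
rewrite (sumJ (fun k i => if (z <= dcond i)%N then #|dI (D k)|%:R^-1 *
      `|\sum_(1 <= a < Y.+1) dpsi i a * (coprime a k.+1)%:R| else 0)).
by rewrite [leRHS]big_mkcond.
Qed.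

(* Characters take values in algC, which does not embed in an arbitrary [F]; the inequality is one between rationals. *)
Lemma family_deviation_transfer (F : numFieldType) X Y B (h r : nat -> nat) :
  \sum_(1 <= n < X.+1) `|(h n)%:R - Y%:R * (r n)%:R / n%:R| <= B%:R :> algC ->
  \sum_(1 <= n < X.+1) `|(h n)%:R - Y%:R * (r n)%:R / n%:R| <= B%:R :> F.
Proof.
have E (K : numFieldType) : \sum_(1 <= n < X.+1) `|(h n)%:R - Y%:R * (r n)%:R / n%:R| =
   ratr (\sum_(1 <= n < X.+1) `|(h n)%:R - Y%:R * (r n)%:R / n%:R|) :> K.
  rewrite rmorph_sum /=; apply: eq_bigr => n _.
  by rewrite ratr_norm rmorphB /= !rmorphM /= fmorphV !rmorph_nat.
have EB (K : numFieldType) : B%:R = ratr B%:R :> K by rewrite ratr_nat.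
by rewrite (E F) (E algC) (EB F) (EB algC) !ler_rat.
Qed.

(** * Multiplicative energy *)

Definition small_primes (P : nat) : nat_pred := [pred p | (p <= P)%N].

Definition smooth_count (P Y : nat) : nat :=
  #|[set a : 'I_Y | (small_primes P).-nat a.+1]|.

Definition rough (P : nat) : pred nat := fun g => (small_primes P)^'.-nat g.

Definition rough_pairs (P r Y : nat) : {set {ffun 'I_r -> 'I_Y} * {ffun 'I_r -> 'I_Y}} :=
  [set fg : {ffun 'I_r -> 'I_Y} * {ffun 'I_r -> 'I_Y} |
     [&& (\prod_i (fg.1 i).+1)%N == (\prod_i (fg.2 i).+1)%N,
         [forall i, rough P (fg.1 i).+1] & [forall i, rough P (fg.2 i).+1]]].

Lemma part_pred_ltn pi Y (a : 'I_Y) : (((a.+1)`_pi).-1 < Y)%N.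
Proof. by rewrite prednK ?part_gt0 //; apply: leq_trans (dvdn_leq _ (dvdn_part _ _)) _. Qed.

Definition ord_part pi Y (a : 'I_Y) : 'I_Y := Ordinal (part_pred_ltn pi a).

Lemma ord_partE pi Y (a : 'I_Y) : (ord_part pi a).+1 = ((a.+1)`_pi)%N.
Proof. by rewrite /= prednK ?part_gt0. Qed.

(** Every variable is split into its smooth and rough parts. The equation passes to the rough parts
    and is forgotten for the [2 * r] smooth ones, which are counted freely. *)
Lemma energy_smooth_rough P r Y :
  (energy r Y <= smooth_count P Y ^ (2 * r) * #|rough_pairs P r Y|)%N.
Proof.
set pi := small_primes P.
pose pt tau (f : {ffun 'I_r -> 'I_Y}) : {ffun 'I_r -> 'I_Y} := [ffun i => ord_part tau (f i)].
pose h (fg : {ffun 'I_r -> 'I_Y} * {ffun 'I_r -> 'I_Y}) :=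
  ((pt pi fg.1, pt pi fg.2), (pt pi^' fg.1, pt pi^' fg.2)).
have hinj : injective h.
  have K f f' : pt pi f = pt pi f' -> pt pi^' f = pt pi^' f' -> f = f'.
    move=> /ffunP E1 /ffunP E2; apply/ffunP => i; apply: val_inj; apply: succn_inj.
    rewrite -[LHS](partnC pi) // -[RHS](partnC pi) // -!ord_partE.
    by have := E1 i; have := E2 i; rewrite !ffunE => -> ->.
  by move=> [f g] [f' g'] [] /K e1 /K e2 /e1 -> /e2 ->.
rewrite /energy -(card_imset _ hinj).
set A := [set a : 'I_Y | pi.-nat a.+1].
pose B : {set {ffun 'I_r -> 'I_Y}} := [set f | f \in ffun_on A].
have cB : #|B| = (smooth_count P Y ^ r)%N by rewrite cardsE card_ffun_on card_ord.
have -> : (smooth_count P Y ^ (2 * r) = #|finset.setX B B|)%N by rewrite cardsX cB mul2n -addnn expnD.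
rewrite -cardsX; apply: subset_leq_card; apply/fintype.subsetP => _ /imsetP [[f g] Hfg ->].
have ptB f' : pt pi f' \in B.
  by rewrite inE; apply/ffun_onP => i; rewrite inE ffunE ord_partE part_pnat.
have ptR f' : [forall i, rough P (pt pi^' f' i).+1].
  by apply/forallP => i; rewrite ffunE ord_partE /rough part_pnat.
move: Hfg; rewrite inE /= => /eqP Hfg.
rewrite !finset.in_setX !ptB /= inE /= !ptR !andbT.
have E f' : (\prod_i (pt pi^' f' i).+1 = (\prod_i (f' i).+1)`_pi^')%N.
  suff [] : (\prod_i (pt pi^' f' i).+1 = (\prod_i (f' i).+1)`_pi^')%N /\
      (0 < \prod_i (f' i).+1)%N by [].
  elim/big_rec2: _ => [|i x y _ [-> y0]]; first by rewrite partn1.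
  by rewrite muln_gt0 y0 partnM // ffunE ord_partE.
by rewrite !E Hfg.
Qed.

(** The existential precedes the membership hypothesis so that choice provides a function on all
    pairs; the row and column products make it injective on the rough ones. *)
Lemma rough_matrix P r Y (fg : {ffun 'I_r -> 'I_Y} * {ffun 'I_r -> 'I_Y}) :
  exists G : {ffun 'I_r * 'I_r -> 'I_Y}, fg \in rough_pairs P r Y ->
    [/\ forall i, (fg.1 i).+1 = (\prod_j (G (i, j)).+1)%N,
        forall j, (fg.2 j).+1 = (\prod_i (G (i, j)).+1)%N &
        forall i j, rough P (G (i, j)).+1].
Proof.
case: (boolP (fg \in rough_pairs P r Y)) => [|_]; last by exists [ffun ij => fg.1 ij.1].
rewrite inE => /and3P [/eqP E /forallP R1 /forallP R2].
pose ext (f : {ffun 'I_r -> 'I_Y}) k := if insub k is Some i then (f i).+1 else 1%N.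
have extE f (i : 'I_r) : ext f i = (f i).+1 by rewrite /ext valK.
have [||G [G1 G2]] := @matrix_factorization r r (ext fg.1) (ext fg.2).
- by move=> i _; rewrite /ext; case: insub.
- by under eq_bigr do rewrite extE; rewrite E; apply: eq_bigr => i _; rewrite extE.
have Gd (i j : 'I_r) : (G i j %| (fg.1 i).+1)%N.
  by rewrite -extE G1 // (bigD1 j) //= dvdn_mulr.
have G0 (i j : 'I_r) : (0 < G i j)%N by apply: dvdn_gt0 (Gd i j).
have GY (i j : 'I_r) : ((G i j).-1 < Y)%N.
  rewrite prednK //; apply: leq_trans (dvdn_leq _ (Gd i j)) _ => //.
have GE (i j : 'I_r) : ([ffun ij : 'I_r * 'I_r => Ordinal (GY ij.1 ij.2)] (i, j)).+1 = G i j.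
  by rewrite ffunE /= prednK.
exists [ffun ij => Ordinal (GY ij.1 ij.2)] => _; split.
- by move=> i; under eq_bigr do rewrite GE; rewrite -G1 // extE.
- by move=> j; under eq_bigr do rewrite GE; rewrite -G2 // extE.
- by move=> i j; rewrite GE; apply: pnat_dvd (Gd i j) (R1 i).
Qed.

(* Rankin's trick: a matrix whose row products are at most [Y] is counted with the weight
   [phi Y ^+ r] divided by the values of [phi] at its entries, which is at least 1. *)
Lemma rough_pairs_bound (R : realFieldType) (phi : nat -> R) P r Y : (0 < Y)%N ->
  (forall a b, (0 < a)%N -> (0 < b)%N -> phi (a * b)%N = phi a * phi b) -> phi 1%N = 1 ->
  (forall a b, (0 < a <= b)%N -> 0 < phi a <= phi b) ->
  #|rough_pairs P r Y|%:R <=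
  phi Y ^+ r * (\sum_(1 <= g < Y.+1 | rough P g) (phi g)^-1) ^+ (r * r).
Proof.
move=> Y0 phiM phi1 phi_mono.
pose MS : {set {ffun 'I_r * 'I_r -> 'I_Y}} :=
  [set G : {ffun 'I_r * 'I_r -> 'I_Y} | (G \in ffun_on (fun g : 'I_Y => rough P g.+1)) &&
     [forall i, (\prod_j (G (i, j)).+1 <= Y)%N]].
have card_MS : (#|rough_pairs P r Y| <= #|MS|)%N.
  have /boolp.choice [h Hh] := @rough_matrix P r Y.
  have hinj : {in rough_pairs P r Y &, injective h}.
    move=> [f g] [f' g'] /Hh /= [H1 H2 _] /Hh /= [H1' H2' _] E.
    congr (_, _); apply/ffunP => i; apply: val_inj; apply: succn_inj.
      by rewrite H1 H1' E.
    by rewrite H2 H2' E.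
  rewrite -(card_in_imset hinj); apply: subset_leq_card.
  apply/fintype.subsetP => _ /imsetP [fg /Hh [H1 H2 H3] ->]; rewrite inE; apply/andP; split.
    by apply/ffun_onP => [] [i j]; exact: H3.
  by apply/forallP => i; rewrite -H1 ltn_ord.
apply: (@le_trans _ _ #|MS|%:R); first by rewrite ler_nat.
have phi_prod (G : {ffun 'I_r * 'I_r -> 'I_Y}) i :
   phi (\prod_j (G (i, j)).+1)%N = \prod_j phi (G (i, j)).+1.
  suff [] : phi (\prod_j (G (i, j)).+1)%N = \prod_j phi (G (i, j)).+1 /\
     (0 < \prod_j (G (i, j)).+1)%N by [].
  elim/big_rec2: _ => // j x y _ [E y0]; rewrite muln_gt0 y0 phiM // E //.
have phi_gt0 g : 0 < phi g.+1 by have := phi_mono g.+1 g.+1; rewrite leqnn => /(_ isT) /andP[].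
have -> : \sum_(1 <= g < Y.+1 | rough P g) (phi g)^-1 =
   \sum_(g < Y | rough P g.+1) (phi g.+1)^-1.
  by rewrite big_add1 big_mkord.
have -> : phi Y ^+ r * (\sum_(g < Y | rough P g.+1) (phi g.+1)^-1) ^+ (r * r) =
  \sum_(G in ffun_on (fun g : 'I_Y => rough P g.+1))
     phi Y ^+ r * \prod_(ij : 'I_r * 'I_r) (phi (G ij).+1)^-1.
  rewrite -mulr_sumr; congr (_ * _).
  rewrite -(bigA_distr_big (fun g : 'I_Y => rough P g.+1)
    (fun (_ : 'I_r * 'I_r) (g : 'I_Y) => (phi g.+1)^-1)).
  by rewrite prodr_const card_prod card_ord.
rewrite -sum1_card natr_sum /MS.
apply: (@le_trans _ _ (\sum_(G in MS) phi Y ^+ r * \prod_(ij : 'I_r * 'I_r) (phi (G ij).+1)^-1)).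
  apply: ler_sum => G; rewrite inE => /andP [_ /forallP GY].
  rewrite (eq_bigr (fun ij : 'I_r * 'I_r => (phi (G (ij.1, ij.2)).+1)^-1)); last by move=> [].
  rewrite -(pair_bigA _ (fun i j => (phi (G (i, j)).+1)^-1)) /=.
  have -> : phi Y ^+ r = \prod_(i < r) phi Y by rewrite prodr_const card_ord.
  rewrite -big_split /=.
  apply: (@le_trans _ _ (\prod_(i < r) (1 : R))); first by rewrite prodr_const expr1n.
  apply: ler_prod => i _; rewrite ler01 /= prodfV -phi_prod.
  have pos : (0 < \prod_j (G (i, j)).+1)%N by apply: prodn_gt0.
  have := phi_mono (\prod_j (G (i, j)).+1)%N Y; rewrite pos (GY i) => /(_ isT) /andP [p0 pY].
  by rewrite ler_pdivlMr // mul1r.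
rewrite [leLHS]big_mkcond [leRHS]big_mkcond /=; apply: ler_sum => G _; rewrite inE.
case: (G \in ffun_on _) => //=; case: ifP => // _.
apply: mulr_ge0; last by apply: prodr_ge0 => ij _; rewrite invr_ge0 ltW.
by rewrite exprn_ge0 // ltW // -(prednK Y0).
Qed.

(** * Smooth numbers, the second moment of 2^omega, and Rankin sums *)

Lemma logn_le_trunc_log p a : (0 < a)%N -> (logn p a <= trunc_log 2 a)%N.
Proof.
move=> a0; have [pp|np] := boolP (prime p); last by rewrite lognE (negbTE np).
apply: trunc_log_max => //; apply: leq_trans (dvdn_leq a0 (pfactor_dvdnn p a)).
case: (logn p a) => [|k]; first by rewrite !expn0.
by rewrite leq_exp2r // prime_gt1.
Qed.

(** A smooth number is determined by its exponents at the primes up to [P], each at most [log_2 Y];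
    for fixed [P] the count is polylogarithmic. *)
Lemma smooth_count_le P Y : (smooth_count P Y <= (trunc_log 2 Y).+1 ^ P.+1)%N.
Proof.
pose h (a : 'I_Y) : {ffun 'I_P.+1 -> 'I_(trunc_log 2 Y).+1} :=
  [ffun p : 'I_P.+1 => inord (logn p a.+1)].
have hE (a : 'I_Y) (p : 'I_P.+1) : h a p = logn p a.+1 :> nat.
  rewrite ffunE inordK // ltnS; apply: leq_trans (logn_le_trunc_log _ _) _ => //.
  by apply: leq_trunc_log.
set A := [set a : 'I_Y | (small_primes P).-nat a.+1].
have hinj : {in A &, injective h}.
  move=> a b; rewrite !inE => sa sb E; apply: val_inj; apply: succn_inj.
  apply: eqn_from_log => // p; have [pP|pP] := leqP p P.
    have := hE a (inord p); have := hE b (inord p).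
    by rewrite E inordK // => -> ->.
  have K c : (small_primes P).-nat c.+1 -> logn p c.+1 = 0%N.
    move=> /pnatP sc; apply/eqP; rewrite -leqn0 leqNgt logn_gt0 mem_primes /=.
    apply/negP => /andP [pp pc]; have := sc isT p pp pc.
    by rewrite inE leqNgt pP.
  by rewrite !K.
rewrite /smooth_count -/A -(card_in_imset hinj).
apply: leq_trans (max_card _) _; by rewrite card_ffun !card_ord.
Qed.

(** A set of prime divisors is determined by the part of [n] supported on it, which is a divisor of
    [n]. *)
Lemma pow2_omega_le n X : (0 < n <= X)%N ->
  (2 ^ size (primes n) <= \sum_(1 <= a < X.+1) (a %| n))%N.
Proof.
move=> /andP [n0 nX].
have -> : (\sum_(1 <= a < X.+1) (a %| n) = #|[set a : 'I_X.+1 | (0 < a) && (a %| n)]|)%N.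
  rewrite big_geq_mkord -sum1_card big_mkcond [RHS]big_mkcond /=; apply: eq_bigr => a _.
  by rewrite inE; case: (0 < a)%N; case: (a %| n)%N.
set ps := primes n.
pose piK (K : {set 'I_(size ps)}) : nat_pred := [pred p | [exists i in K, p == nth 0%N ps i]].
pose h K : 'I_X.+1 := inord n`_(piK K).
have hE K : h K = (n`_(piK K))%N :> nat.
  by rewrite inordK // ltnS; apply: leq_trans (dvdn_leq n0 (dvdn_part _ _)) _.
have hinj : injective h.
  have mem (K : {set 'I_(size ps)}) (i : 'I_(size ps)) : (i \in K) = (nth 0%N ps i \in primes (h K)).
    rewrite hE primes_part mem_filter mem_nth // andbT !inE.
    apply/idP/idP => [iK|/existsP [j /andP [jK /eqP E]]].
      by apply/existsP; exists i; rewrite iK eqxx.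
    suff -> : i = j by [].
    by apply: val_inj; apply/eqP; rewrite -(nth_uniq 0%N (ltn_ord i) (ltn_ord j) (primes_uniq n)) -/ps E.
  by move=> K K' E; apply/finset.setP => i; rewrite !mem E.
have <- : (#|[set h K | K in [set: {set 'I_(size ps)}]]| = 2 ^ size ps)%N.
  by rewrite card_imset // -powersetT card_powerset cardsT card_ord.
apply: subset_leq_card; apply/fintype.subsetP => _ /imsetP [K _ ->].
by rewrite inE hE part_gt0 dvdn_part.
Qed.

(** A pair of divisors [(a, b)] is sent to [g = gcdn a b], [u = a / g], [v = b / g]; then
    [g * u * v] is their lcm, again a divisor of [n]. Summation over [n] will thus cost the cube of
    a harmonic sum. *)
Lemma pow4_omega_le n X : (0 < n <= X)%N ->
  (4 ^ size (primes n) <= \sum_(1 <= g < X.+1) \sum_(1 <= u < X.+1) \sum_(1 <= v < X.+1)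
      (g * u * v %| n))%N.
Proof.
move=> Hn; have /andP [n0 nX] := Hn; have H := pow2_omega_le Hn.
rewrite -[4%N]/(2 ^ 2)%N -expnM mulnC expnM expnS expn1.
apply: leq_trans (leq_mul H H) _.
rewrite big_distrl /=; under eq_bigr do rewrite big_distrr /=.
pose T g u v a b := ((g * u == a) && (g * v == b) && (g * u * v %| n))%N.
apply: (@leq_trans (\sum_(1 <= a < X.+1) \sum_(1 <= b < X.+1)
   \sum_(1 <= g < X.+1) \sum_(1 <= u < X.+1) \sum_(1 <= v < X.+1) T g u v a b)%N).
  rewrite big_nat [leqRHS]big_nat; apply: leq_sum => a /andP [a0 _].
  rewrite big_nat [leqRHS]big_nat; apply: leq_sum => b /andP [b0 _].
  have [an|//] := boolP (a %| n)%N; have [bn|//] := boolP (b %| n)%N; rewrite /=.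
  have g0 : (0 < gcdn a b)%N by rewrite gcdn_gt0 a0.
  have rng q : (0 < q)%N -> (q %| n)%N -> q \in index_iota 1 X.+1.
    by move=> q0 qn; rewrite mem_index_iota q0 ltnS (leq_trans (dvdn_leq n0 qn)).
  have ga : (0 < a %/ gcdn a b)%N by rewrite divn_gt0 // dvdn_leq // dvdn_gcdl.
  have gb : (0 < b %/ gcdn a b)%N by rewrite divn_gt0 // dvdn_leq // dvdn_gcdr.
  have dvd q c : (q %| c)%N -> (c %/ q %| c)%N by move=> qc; rewrite -{2}(divnK qc) dvdn_mulr.
  rewrite (bigD1_seq (gcdn a b)) ?iota_uniq ?rng //=; last exact: dvdn_trans (dvdn_gcdl _ _) an.
  rewrite (bigD1_seq (a %/ gcdn a b)%N) ?iota_uniq ?rng //=; last first.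
    by apply: dvdn_trans an; apply: dvd; exact: dvdn_gcdl.
  rewrite (bigD1_seq (b %/ gcdn a b)%N) ?iota_uniq ?rng //=; last first.
    by apply: dvdn_trans bn; apply: dvd; exact: dvdn_gcdr.
  rewrite -addnA -addnA /T.
  have -> : (gcdn a b * (a %/ gcdn a b) = a)%N by rewrite mulnC divnK ?dvdn_gcdl.
  have -> : (gcdn a b * (b %/ gcdn a b) = b)%N by rewrite mulnC divnK ?dvdn_gcdr.
  rewrite !eqxx /= muln_divA ?dvdn_gcdr // -/(lcmn a b).
  by rewrite dvdn_lcm an bn leq_addr.
have ex5 (F : nat -> nat -> nat -> nat -> nat -> nat) :
   (\sum_(1 <= a < X.+1) \sum_(1 <= b < X.+1)
   \sum_(1 <= g < X.+1) \sum_(1 <= u < X.+1) \sum_(1 <= v < X.+1) F g u v a b =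
   \sum_(1 <= g < X.+1) \sum_(1 <= u < X.+1) \sum_(1 <= v < X.+1)
   \sum_(1 <= a < X.+1) \sum_(1 <= b < X.+1) F g u v a b)%N.
  under eq_bigr do rewrite exchange_big /=.
  rewrite exchange_big /=; apply: eq_bigr => g _.
  under eq_bigr do rewrite exchange_big /=.
  rewrite exchange_big /=; apply: eq_bigr => u _.
  under eq_bigr do rewrite exchange_big /=.
  by rewrite exchange_big.
rewrite ex5; apply: leq_sum => g _; apply: leq_sum => u _; apply: leq_sum => v _.
have one c : (\sum_(1 <= a < X.+1) (c == a) <= 1)%N.
  have [cX|cX] := boolP (c \in index_iota 1 X.+1).
    rewrite (bigD1_seq c) ?iota_uniq //= eqxx big1 // => a; rewrite eq_sym.
    by move=> /negbTE ->.
  rewrite big_seq big1 // => a aX; case: eqP => // E; by rewrite E aX in cX.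
apply: (@leq_trans (\sum_(1 <= a < X.+1) \sum_(1 <= b < X.+1)
   ((g * u == a) * ((g * v == b) * (g * u * v %| n))))%N).
  by apply: leq_sum => a _; apply: leq_sum => b _; rewrite /T -!mulnb mulnA.
under eq_bigr do rewrite -big_distrr -big_distrl /=.
rewrite -big_distrl /= -[leqRHS]mul1n -[X in (_ <= 1 * X)%N]mul1n.
by apply: leq_mul (one _) _; apply: leq_mul (one _) _.
Qed.

Lemma sum_dvdn m X : (0 < m)%N -> (\sum_(1 <= n < X.+1) (m %| n) = X %/ m)%N.
Proof.
move=> m0; elim: X => [|X IH]; first by rewrite div0n big_geq.
by rewrite big_nat_recr //= IH divnS // addnC.
Qed.

Definition harmonic_sum (R : realType) (X : nat) : R := \sum_(1 <= k < X.+1) k%:R^-1.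

Lemma omega2_sum_le (R : realType) X : (omega2_sum X)%:R <= X%:R * harmonic_sum R X ^+ 3.
Proof.
apply: (@le_trans _ _ (\sum_(1 <= g < X.+1) \sum_(1 <= u < X.+1) \sum_(1 <= v < X.+1)
   (X %/ (g * u * v)))%N%:R).
  rewrite ler_nat /omega2_sum.
  apply: (@leq_trans (\sum_(1 <= n < X.+1) \sum_(1 <= g < X.+1) \sum_(1 <= u < X.+1)
     \sum_(1 <= v < X.+1) (g * u * v %| n))%N).
    rewrite big_nat [leqRHS]big_nat; apply: leq_sum => n; rewrite ltnS; exact: pow4_omega_le.
  rewrite exchange_big /= big_nat [leqRHS]big_nat; apply: leq_sum => g /andP [g0 _].
  rewrite exchange_big /= big_nat [leqRHS]big_nat; apply: leq_sum => u /andP [u0 _].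
  rewrite exchange_big /= big_nat [leqRHS]big_nat; apply: leq_sum => v /andP [v0 _].
  by rewrite sum_dvdn // !muln_gt0 g0 u0.
have -> : X%:R * harmonic_sum R X ^+ 3 = \sum_(1 <= g < X.+1) \sum_(1 <= u < X.+1)
   \sum_(1 <= v < X.+1) X%:R * (g%:R^-1 * (u%:R^-1 * v%:R^-1)).
  rewrite exprS expr2 /harmonic_sum mulr_suml mulr_sumr; apply: eq_bigr => g _.
  rewrite [X in g%:R^-1 * X]mulr_suml !mulr_sumr; apply: eq_bigr => u _.
  by rewrite !mulr_sumr.
rewrite natr_sum big_nat [leRHS]big_nat; apply: ler_sum => g /andP [g0 _].
rewrite natr_sum big_nat [leRHS]big_nat; apply: ler_sum => u /andP [u0 _].
rewrite natr_sum big_nat [leRHS]big_nat; apply: ler_sum => v /andP [v0 _].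
have -> : X%:R * (g%:R^-1 * (u%:R^-1 * v%:R^-1)) = X%:R / (g * u * v)%:R :> R.
  by rewrite !natrM !invfM -!mulrA.
rewrite ler_pdivlMr; last by rewrite ltr0n !muln_gt0 g0 u0.
by rewrite -natrM ler_nat; exact: leq_divM.
Qed.

Lemma ln_succ_ge (R : realType) k : (0 < k)%N -> k.+1%:R^-1 <= ln k.+1%:R - ln k%:R :> R.
Proof.
move=> k0; have k0' : (0 : R) < k%:R by rewrite ltr0n.
have k1 : (0 : R) < k.+1%:R by rewrite ltr0n.
have E : k%:R / k.+1%:R = 1 - k.+1%:R^-1 :> R.
  by rewrite -[k.+1]addn1 natrD; field; rewrite natr1 gt_eqF.
have H : - 1 < - k.+1%:R^-1 :> R by rewrite ltrN2 invf_lt1 // ltr1n.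
have := le_ln1Dx H; rewrite -E ln_div ?posrE // => L.
by rewrite -lerN2 opprB.
Qed.

Lemma harmonic_sum_le (R : realType) X : (0 < X)%N -> harmonic_sum R X <= 1 + ln X%:R.
Proof.
elim: X => // -[_ _|X IH _]; first by rewrite /harmonic_sum big_nat1 ln1 addr0 invr1.
have -> : harmonic_sum R X.+2 = harmonic_sum R X.+1 + X.+2%:R^-1.
  by rewrite /harmonic_sum big_nat_recr.
apply: le_trans (lerD (IH isT) (@ln_succ_ge R X.+1 isT)) _.
by rewrite le_eqVlt; apply/orP; left; apply/eqP; ring.
Qed.

(** Discrete form of the integral of [t ^ (-1 - eta)]; by [ln_succ_ge] it reduces to
    [1 + v <= expR v]. *)
Lemma powR_telescope (R : realType) (eta : R) g : 0 < eta -> (0 < g)%N ->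
  (g.+1%:R `^ (1 + eta))^-1 <= ((g%:R `^ eta)^-1 - (g.+1%:R `^ eta)^-1) / eta.
Proof.
move=> e0 g0; have g0' : (0 : R) < g%:R by rewrite ltr0n.
have g1 : (0 : R) < g.+1%:R by rewrite ltr0n.
have A0 : 0 < g.+1%:R `^ eta by exact: powR_gt0.
have B0 : 0 < g%:R `^ eta by exact: powR_gt0.
rewrite powRD; last by rewrite (gt_eqF g1) implybT.
rewrite powRr1 ?ler0n // ler_pdivlMr //.
have H : 1 + eta / g.+1%:R <= g.+1%:R `^ eta / g%:R `^ eta.
  rewrite /powR !gt_eqF // -expRB -mulrBr; apply: le_trans (expR_ge1Dx _) _.
  by rewrite ler_expR ler_wpM2l ?ln_succ_ge // ltW.
have -> : (g%:R `^ eta)^-1 - (g.+1%:R `^ eta)^-1 =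
    (g.+1%:R `^ eta / g%:R `^ eta - 1) * (g.+1%:R `^ eta)^-1.
  by field; rewrite !gt_eqF.
rewrite invfM mulrAC; apply: ler_wpM2r; first by rewrite invr_ge0 ltW.
by rewrite mulrC lerBrDl.
Qed.

(** A rough number is 1 or exceeds [P], so besides the leading 1 there is only a tail, small for
    large [P]. This keeps the constant raised to the power [r * r] close to 1. *)
Lemma rough_sum_le (R : realType) (eta : R) P Y : 0 < eta -> (0 < P)%N ->
  \sum_(1 <= g < Y.+1 | rough P g) (g%:R `^ (1 + eta))^-1 <= 1 + (P%:R `^ eta)^-1 / eta.
Proof.
move=> e0 P0.
pose q k : R := (k%:R `^ eta)^-1.
(* The induction carries the telescoped difference; [maxn P Y] keeps it zero until [Y] passes
   [P]. *)
suff H : \sum_(1 <= g < Y.+1 | rough P g) (g%:R `^ (1 + eta))^-1 <=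
   (0 < Y)%:R + (q P - q (maxn P Y)) / eta.
  apply: le_trans H _; apply: lerD; first by case: (0 < Y)%N; rewrite ?ler01.
  by rewrite ler_pM2r ?invr_gt0 // lerBlDr lerDl invr_ge0 powR_ge0.
elim: Y => [|Y IH]; first by rewrite big_geq // maxn0 subrr mul0r addr0.
have -> : \sum_(1 <= g < Y.+2 | rough P g) (g%:R `^ (1 + eta))^-1 =
    \sum_(1 <= g < Y.+1 | rough P g) (g%:R `^ (1 + eta))^-1 +
    (if rough P Y.+1 then (Y.+1%:R `^ (1 + eta))^-1 else 0) :> R.
  by rewrite big_mkcond big_nat_recr //= -big_mkcond.
apply: le_trans (lerD IH (lexx _)) _.
have [YP|PY] := leqP Y.+1 P.
  rewrite (maxn_idPl (ltnW YP)) subrr !mul0r !addr0.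
  case: Y {IH} YP => [|Y] YP.
    by case: (rough P 1%N); rewrite /= ?powR1 ?invr1 add0r.
  suff -> : rough P Y.+2 = false by rewrite addr0.
  apply/negP => /pnatP -/(_ isT) H.
  have pp : prime (pdiv Y.+2) by apply: pdiv_prime.
  have := H _ pp (pdiv_dvd _); rewrite !inE /= => /negP; apply.
  by apply: leq_trans YP; apply: pdiv_leq.
have Y0 : (0 < Y)%N by apply: leq_trans P0 _.
have PY' : (P <= Y)%N by [].
rewrite (maxn_idPr PY') Y0 /= -addrA lerD2l.
have := @powR_telescope R eta Y e0 Y0; rewrite -/(q Y) -/(q Y.+1) => T.
have T0 : 0 <= (q Y - q Y.+1) / eta by apply: le_trans T; rewrite invr_ge0 powR_ge0.
have : (if rough P Y.+1 then (Y.+1%:R `^ (1 + eta))^-1 else 0) <= (q Y - q Y.+1) / eta.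
  by case: (rough P Y.+1).
have -> : (q P - q Y.+1) / eta = (q P - q Y) / eta + (q Y - q Y.+1) / eta.
  by rewrite -mulrDl addrA subrK.
by rewrite lerD2l.
Qed.

Lemma energy_le (R : realType) (eta : R) P r Y : 0 < eta -> (0 < P)%N -> (0 < Y)%N ->
  (energy r Y)%:R <= (((trunc_log 2 Y).+1 ^ P.+1) ^ (2 * r))%:R *
    ((Y%:R `^ (1 + eta)) ^+ r * (1 + (P%:R `^ eta)^-1 / eta) ^+ (r * r)).
Proof.
move=> e0 P0 Y0.
have phi_mono a b : (0 < a <= b)%N -> 0 < a%:R `^ (1 + eta) <= b%:R `^ (1 + eta).
  move=> /andP [a0 ab]; rewrite powR_gt0 ?ltr0n //=.
  by apply: ge0_ler_powR; rewrite ?nnegrE ?ler0n ?ler_nat //; lra.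
have phiM a b : (0 < a)%N -> (0 < b)%N ->
   (a * b)%:R `^ (1 + eta) = a%:R `^ (1 + eta) * b%:R `^ (1 + eta).
  by move=> _ _; rewrite natrM powRM.
have phi1 : 1%:R `^ (1 + eta) = 1 by rewrite powR1.
have H := @rough_pairs_bound R (fun g => g%:R `^ (1 + eta)) P r Y Y0 phiM phi1 phi_mono.
apply: (@le_trans _ _ ((smooth_count P Y ^ (2 * r))%:R * #|rough_pairs P r Y|%:R)).
  by rewrite -natrM ler_nat energy_smooth_rough.
apply: ler_pM => //.
  rewrite ler_nat; case: (posnP r) => [->|r0]; first by rewrite !expn0.
  by rewrite leq_exp2r ?muln_gt0 ?r0 // smooth_count_le.
apply: le_trans H _; apply: ler_wpM2l; first by rewrite exprn_ge0 ?powR_ge0.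
apply: lerXn2r; rewrite ?nnegrE.
- by apply: sumr_ge0 => g _; rewrite invr_ge0 powR_ge0.
- by rewrite addr_ge0 // divr_ge0 ?invr_ge0 ?powR_ge0 ?ltW.
exact: rough_sum_le.
Qed.

(** * Equidistribution in subgroups on average *)

Lemma poly_le_expR (R : realType) (A c : R) k : 0 < c ->
  exists x0 : R, forall x, x0 <= x -> A * (1 + x) ^+ k <= expR (c * x).
Proof.
move=> c0; pose D := `|A| * 2 ^+ k * (k.+1)`!%:R / c ^+ k.+1.
exists (Num.max 1 D) => x; rewrite ge_max => /andP [x1 xD].
have x0 : 0 < x by lra.
have f0 : 0 < ((k.+1)`!%:R : R) by rewrite ltr0n fact_gt0.
have ck : 0 < c ^+ k.+1 by rewrite exprn_gt0.
apply: le_trans (_ : `|A| * (2 ^+ k * x ^+ k) <= _).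
  apply: (@le_trans _ _ (`|A| * (1 + x) ^+ k)).
    by apply: ler_wpM2r; [apply: exprn_ge0; lra|exact: ler_norm].
  apply: ler_wpM2l => //; rewrite -exprMn; apply: lerXn2r; rewrite ?nnegrE; lra.
have H := @expR_ge1Dxn R (c * x) k (ltW (mulr_gt0 c0 x0)).
apply: le_trans (_ : (c * x) ^+ k.+1 / (k.+1)`!%:R <= _); last by apply: le_trans H; lra.
rewrite ler_pdivlMr // exprMn [x ^+ k.+1]exprS.
have -> : `|A| * (2 ^+ k * x ^+ k) * (k.+1)`!%:R = (c ^+ k.+1 * D) * x ^+ k.
  by rewrite /D; field; rewrite gt_eqF.
rewrite [leRHS]mulrA; apply: ler_wpM2r; first by rewrite exprn_ge0 // ltW.
by rewrite ler_pM2l.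
Qed.

Lemma ln2_ge_half (R : realType) : 2^-1 <= ln 2%:R :> R.
Proof. by have := @ln_succ_ge R 1 isT; rewrite ln1 subr0. Qed.

Lemma trunc_log2_le_ln (R : realType) Y : (0 < Y)%N -> (trunc_log 2 Y)%:R <= 2 * ln Y%:R :> R.
Proof.
move=> Y0; have H : (2 ^ trunc_log 2 Y <= Y)%N by exact: trunc_logP.
have : ln (2%:R ^+ trunc_log 2 Y) <= ln Y%:R :> R.
  by rewrite ler_ln ?posrE ?exprn_gt0 ?ltr0n // -natrX ler_nat.
rewrite lnXn ?ltr0n // -[ln _ *+ _]mulr_natl => H1.
have := ler_wpM2l (ler0n R (trunc_log 2 Y)) (ln2_ge_half R).
move=> /le_trans /(_ H1); rewrite ler_pdivrMr ?ltr0n //.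
by rewrite mulrC.
Qed.

Lemma rough_parameter (R : realType) (eta e : R) : 0 < eta -> 0 < e ->
  exists2 P, (0 < P)%N & (P%:R `^ eta)^-1 / eta <= e.
Proof.
move=> e0 e1; pose t := eta^-1 * (eta * e)^-1.
have [P HP] : exists P, expR t < P%:R.
  by exists (Num.bound (expR t)); rewrite archi_boundP ?expR_ge0.
have P0 : (0 : R) < P%:R by apply: lt_trans HP; exact: expR_gt0.
exists P; first by rewrite -(ltr0n R).
have q0 : 0 < P%:R `^ eta by exact: powR_gt0.
rewrite ler_pdivrMr // invf_ple ?posrE ?mulr_gt0 // /powR gt_eqF //.
have tP : t < ln P%:R by rewrite -(expRK t) ltr_ln ?posrE ?expR_gt0.
apply: le_trans (expR_ge1Dx _); apply: (@le_trans _ _ (eta * t)).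
  by rewrite /t mulVKf ?gt_eqF // mulrC.
apply: (@le_trans _ _ (eta * ln P%:R)); first by rewrite ler_pM2l // ltW.
by rewrite lerDr ler01.
Qed.

Lemma succn_pow_le k w : (2 <= w)%N -> (w.+1 ^ k <= w ^ (2 * k))%N.
Proof.
move=> w2; have w1 : (w.+1 <= w ^ 2)%N.
  by apply: (@leq_trans (w * 2)); [lia|rewrite expnS expn1 leq_mul2l w2 orbT].
by rewrite expnM; case: k => // k; rewrite leq_exp2r.
Qed.

(** The powers of [z] in the off-diagonal term at level [r]: [4 * (r + 1)] from the conductors, 1
    from [omega2_sum X <= X * z], and [r] from the comparison with the diagonal term. Since
    [z ^ 10 <= Y], together they stay below [Y ^ r]; this dictates the size of [z]. *)
Lemma level_exponent_le r : (0 < r)%N -> (r + r.+1 * 4 + 1 <= 10 * r)%N.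
Proof. lia. Qed.

Lemma natr_level (R : realType) a Y r c k m D E :
  ((a * Y ^ r + (c ^ k) ^ m * D) * E)%:R =
  (a%:R * Y%:R ^+ r + (c%:R ^+ k) ^+ m * D%:R) * E%:R :> R.
Proof. by rewrite natrM natrD natrM [(_ * D)%:R]natrM !natrX. Qed.

(** The bound on [ln X] limits the levels to [r <= 25 * ln w]. There is no upper bound on [Y]: once
    [X < z] no level occurs. *)
Lemma family_deviation_small (R : realType) : exists L0 : R, forall (w X Y : nat) (H : nat -> pred nat),
  (0 < w)%N -> L0 <= ln w%:R -> (0 < X)%N -> (w ^ 40 <= Y)%N -> (Y < w.+1 ^ 40)%N ->
  ln (X%:R : R) <= 100%:R * ln w%:R ^+ 2 ->
  (forall n, (0 < n <= X)%N -> residue_submonoid n (H n)) ->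
  \sum_(1 <= n < X.+1) `|(hits (H n) Y)%:R - Y%:R * (residues n (H n))%:R / n%:R|
    <= X%:R * Y%:R * expR (- (ln w%:R / 2%:R)) :> R.
Proof.
(* With [l = ln w]: [ln Y <= 80 * l] gives [Y ^ (1/160) <= exp (l / 2)], and [r <= 25 * l] gives
   [exp (1/50) ^ r <= exp (l / 2)]. *)
have [P P0 HP] := @rough_parameter R 160%:R^-1 50%:R^-1 ltac:(lra) ltac:(lra).
have [L1 HL1] := @poly_le_expR R (10%:R ^+ 6) 1 6 ltr01.
have [L2 HL2] := @poly_le_expR R (160%:R ^+ (P.+1 * 2)) 2%:R^-1 (P.+1 * 2) ltac:(lra).
have [L3 HL3] := @poly_le_expR R 2%:R 4%:R^-1 0 ltac:(lra).
have [L4 HL4] := @poly_le_expR R 200%:R 2%:R^-1 1 ltac:(lra).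
exists (Num.max 1 (Num.max (Num.max L1 L2) (Num.max L3 L4))).
move=> w X Y H w0; rewrite !ge_max => /and3P [l1 /andP [lL1 lL2] /andP [lL3 lL4]].
move=> X0 wY Yw lnX Hsub.
set l := ln w%:R in l1 lL1 lL2 lL3 lL4 lnX *.
have {HL1}C1 := HL1 _ lL1; have {HL2}C2 := HL2 _ lL2.
have {HL3}C3 := HL3 _ lL3; have {HL4}C4 := HL4 _ lL4.
have w0' : (0 : R) < w%:R by rewrite ltr0n.
have wE : w%:R = expR l :> R by rewrite lnK.
have w2 : (2 <= w)%N.
  rewrite -(ler_nat R) wE; apply: le_trans (expR_ge1Dx _); lra.
have Y0 : (0 < Y)%N by apply: leq_trans wY; rewrite expn_gt0 w0.
have Y0' : (0 : R) < Y%:R by rewrite ltr0n.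
have X0' : (0 : R) < X%:R by rewrite ltr0n.
have lX0 : 0 <= ln X%:R :> R by rewrite ln_ge0 // ler1n.
set z := (w ^ 4)%N.
have z1 : (1 < z)%N by rewrite /z -(expn0 w) ltn_exp2l.
have lnY : ln Y%:R <= 80%:R * l :> R.
  have -> : 80%:R * l = ln (w%:R ^+ 80) by rewrite lnXn // mulr_natl.
  rewrite ler_ln ?posrE ?exprn_gt0 // -natrX ler_nat; apply: leq_trans (ltnW Yw) _.
  exact: (succn_pow_le 40 w2).
have D2 : (omega2_sum X)%:R <= X%:R * w%:R :> R.
  apply: le_trans (@omega2_sum_le R X) _; rewrite ler_pM2l //.
  have h0 : 0 <= harmonic_sum R X by apply: sumr_ge0 => k _; rewrite invr_ge0.
  have h1 := @harmonic_sum_le R X X0.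
  apply: (@le_trans _ _ ((10%:R * (1 + l)) ^+ 2 ^+ 3)).
    apply: lerXn2r; rewrite ?nnegrE ?exprn_ge0 //; first by lra.
    apply: le_trans h1 _; rewrite exprMn; nra.
  by rewrite -exprM exprMn wE -[l in leRHS]mul1r.
have r25 r : (z ^ r <= X)%N -> r%:R <= 25%:R * l.
  move=> zr; have : ln (w%:R ^+ (4 * r)) <= ln X%:R :> R.
    by rewrite ler_ln ?posrE ?exprn_gt0 // -natrX ler_nat expnM.
  rewrite lnXn // -/l -[l *+ _]mulr_natr natrM => H1.
  rewrite -(ler_pM2l (_ : 0 < 4%:R * l)); last by lra.
  have -> : 4%:R * l * (25%:R * l) = 100%:R * l ^+ 2 by ring.
  by apply: le_trans lnX; apply: le_trans H1; rewrite mulrA [l * _]mulrC.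
(* The size aimed at for a character sum, rounded up so that [Y / w <= b]. *)
set b := (Y %/ w).+1.
have bY : Y%:R / w%:R <= b%:R :> R.
  by rewrite ler_pdivrMr // -natrM ler_nat ltnW // ltn_ceil.
have cond r : (0 < r <= trunc_log z X)%N ->
    ((X %/ z ^ r * Y ^ r + (z ^ r.+1) ^ 4 * omega2_sum X) * energy r Y <= X * b ^ (2 * r))%N.
  move=> /andP [r0 rR].
  have zr : (z ^ r <= X)%N by apply: leq_trans (trunc_logP z1 X0); rewrite leq_exp2l.
  have rl := r25 _ zr.
  rewrite -(ler_nat R) natr_level natrM natrX.
  set y : R := Y%:R in Y0' lnY bY *; set x : R := X%:R in X0' D2 *.
  set v : R := w%:R in w0' wE D2 bY *.
  set zz : R := z%:R.
  have zzE : zz = v ^+ 4 by rewrite /zz /z natrX.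
  have zz1 : 1 <= zz by rewrite ler1n ltnW.
  have v1 : 1 <= v by rewrite ler1n.
  have yz : zz ^+ 10 <= y by rewrite zzE -exprM -natrX ler_nat.
  have zr0 : 0 < zz ^+ r by rewrite exprn_gt0 // zzE exprn_gt0.
  have N1 : (X %/ z ^ r)%:R * y ^+ r <= x * y ^+ r / zz ^+ r.
    rewrite mulrAC; apply: ler_wpM2r; first by rewrite exprn_ge0 // ltW.
    by rewrite ler_pdivlMr // /zz -natrX -natrM ler_nat leq_divM.
  have N2 : (zz ^+ r.+1) ^+ 4 * (omega2_sum X)%:R <= x * y ^+ r / zz ^+ r.
    apply: (@le_trans _ _ ((zz ^+ r.+1) ^+ 4 * (x * zz))).
      apply: ler_wpM2l; first by rewrite !exprn_ge0 //; clear - zz1; lra.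
      apply: le_trans D2 _; rewrite ler_pM2l // zzE.
      by rewrite -{1}[v]expr1 ler_weXn2l.
    rewrite ler_pdivlMr //.
    have -> : (zz ^+ r.+1) ^+ 4 * (x * zz) * zz ^+ r = x * zz ^+ (r + r.+1 * 4 + 1).
      by rewrite -exprM !exprD expr1; ring.
    rewrite ler_pM2l //; apply: (@le_trans _ _ ((zz ^+ 10) ^+ r)).
      by rewrite -exprM; apply: ler_weXn2l => //; exact: level_exponent_le.
    by apply: lerXn2r; rewrite ?nnegrE ?exprn_ge0 //.
  have E1 := @energy_le R 160%:R^-1 P r Y ltac:(lra) P0 Y0.
  set T := ((trunc_log 2 Y).+1 ^ P.+1)%N in E1.
  pose kap : R := 1 + (P%:R `^ 160%:R^-1)^-1 / 160%:R^-1; rewrite -/kap in E1.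
  pose U : R := T%:R ^+ 2 * y `^ 160%:R^-1 * kap ^+ r.
  have kap0 : 0 <= kap.
    by rewrite /kap addr_ge0 // divr_ge0 ?invr_ge0 ?powR_ge0 ?ler0n.
  have U0 : 0 <= U by rewrite !mulr_ge0 ?exprn_ge0 ?powR_ge0 ?ler0n.
  have {}E1 : (energy r Y)%:R <= y ^+ r * U ^+ r.
    apply: le_trans E1 _; rewrite le_eqVlt; apply/orP; left; apply/eqP.
    rewrite natrX -/y powRD; last by rewrite (gt_eqF Y0') implybT.
    rewrite powRr1 ?(ltW Y0') // /U !exprMn -!exprM mul2n -addnn exprD; ring.
  (* [U] is the loss of the energy over [Y ^ r], per factor. The smooth parts, [Y ^ eta] and the
     rough constant cost at most [exp (l / 2)] each and the 2 costs [exp (l / 4)]: less than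
     [w ^ 2], so half of the saving [z = w ^ 4] survives. *)
  have U2 : 2%:R * U <= v ^+ 2.
    have t1 : T%:R ^+ 2 <= expR (2%:R^-1 * l).
      apply: le_trans C2; rewrite /T natrX -exprM -exprMn.
      apply: lerXn2r; rewrite ?nnegrE; [exact: ler0n|by clear - l1; lra|].
      have := @trunc_log2_le_ln R Y Y0; rewrite -[_.+1]addn1 natrD -/y.
      by clear - lnY l1; lra.
    have t2 : y `^ 160%:R^-1 <= expR (2%:R^-1 * l).
      by rewrite /powR gt_eqF // ler_expR; clear - lnY; lra.
    have t3 : kap ^+ r <= expR (2%:R^-1 * l).
      apply: (@le_trans _ _ (expR 50%:R^-1 ^+ r)).
        apply: lerXn2r; rewrite ?nnegrE ?expR_ge0 //; apply: le_trans (expR_ge1Dx _).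
        by rewrite lerD2l.
      by rewrite -expRM_natr ler_expR; clear - rl; lra.
    have t4 : 2%:R <= expR (4%:R^-1 * l) :> R by move: C3; rewrite expr0 mulr1.
    have -> : v ^+ 2 = expR (2%:R * l) by rewrite wE -expRM_natl.
    apply: (@le_trans _ _ (expR (4%:R^-1 * l) * (expR (2%:R^-1 * l) * expR (2%:R^-1 * l) *
        expR (2%:R^-1 * l)))).
      apply: ler_pM => //; apply: ler_pM => //; rewrite ?mulr_ge0 ?exprn_ge0 ?powR_ge0 ?ler0n //.
      by apply: ler_pM => //; rewrite ?exprn_ge0 ?powR_ge0 ?ler0n.
    by rewrite -!expRD ler_expR; clear - l1; lra.
  clearbody U.
  have K0 : 0 <= x * y ^+ r / zz ^+ r by rewrite !mulr_ge0 ?invr_ge0 ?exprn_ge0 // ltW.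
  apply: (@le_trans _ _ (2%:R * (x * y ^+ r / zz ^+ r) * (y ^+ r * U ^+ r))).
    apply: ler_pM => //.
      by rewrite addr_ge0 // !mulr_ge0 ?exprn_ge0 ?ler0n // ltW.
    by rewrite [2%:R * _]mulr_natl mulr2n; exact: (lerD N1 N2).
  apply: (@le_trans _ _ ((x * y ^+ r / zz ^+ r) * (y ^+ r * (v ^+ 2) ^+ r))).
    have -> : 2%:R * (x * y ^+ r / zz ^+ r) * (y ^+ r * U ^+ r) =
      (x * y ^+ r / zz ^+ r) * (y ^+ r * (2%:R * U ^+ r)).
      by move: (x * y ^+ r / zz ^+ r) (y ^+ r) (U ^+ r) => K0' A' B'; ring.
    apply: ler_wpM2l => //; apply: ler_wpM2l; first by rewrite exprn_ge0 // ltW.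
    apply: (@le_trans _ _ ((2%:R * U) ^+ r)).
      rewrite exprMn; apply: ler_wpM2r; first exact: exprn_ge0.
      by rewrite -{1}[2%:R]expr1 ler_weXn2l // ler1n.
    by apply: lerXn2r; rewrite ?nnegrE ?mulr_ge0 ?exprn_ge0 ?ler0n // ltW.
  have -> : x * y ^+ r / zz ^+ r * (y ^+ r * (v ^+ 2) ^+ r) = x * (y / v) ^+ (2 * r).
    rewrite zzE mul2n -addnn expr_div_n !exprD -!exprM mul2n -addnn.
    have -> : (4 * r = r + r + (r + r))%N by rewrite addnn -mul2n addnn -mul2n mulnA.
    rewrite !exprD; field; rewrite gt_eqF // exprn_gt0 //.
  rewrite ler_pM2l //; apply: lerXn2r; rewrite ?nnegrE ?ler0n //.
  by rewrite divr_ge0 // ltW.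
have := @family_deviation X Y z b (trunc_log z X) H X0 z1 isT (trunc_log_ltn _ z1) Hsub cond.
move=> /(@family_deviation_transfer R) F; apply: le_trans F _.
have RL := r25 _ (trunc_logP z1 X0).
have bU : b%:R <= 2%:R * Y%:R / w%:R :> R.
  rewrite /b -[_.+1]addn1 natrD mulr_natl mulr2n mulrDl; apply: lerD.
    by rewrite ler_pdivlMr // -natrM ler_nat leq_divM.
  rewrite ler_pdivlMr // mul1r ler_nat; apply: leq_trans wY.
  by rewrite -{1}[w]expn1 leq_exp2l.
pose sq : R := expR (2%:R^-1 * l).
have sq0 : 0 < sq by exact: expR_gt0.
have wsq : w%:R = sq ^+ 2 by rewrite wE /sq -expRM_natl; congr expR; clear; lra.
have sq2 : 2%:R <= sq by move: C4; rewrite expr1 -/sq; clear - l1; lra.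
have -> : expR (- (l / 2%:R)) = sq^-1 by rewrite expRN; congr (expR _)^-1; clear; lra.
have Ysq : sq ^+ 80 <= Y%:R.
  have -> : sq ^+ 80 = (w ^ 40)%:R by rewrite natrX wsq -exprM.
  by rewrite ler_nat.
rewrite natrD; set x : R := X%:R in X0' D2 *; set y : R := Y%:R in Y0' bU Ysq *.
have A1 : ((z + 1) * omega2_sum X)%:R <= x * y * sq^-1 / 2%:R.
  apply: (@le_trans _ _ (2%:R * sq ^+ 8 * (x * sq ^+ 2))).
    rewrite natrM; apply: ler_pM => //; last by rewrite -wsq.
    have -> : sq ^+ 8 = z%:R by rewrite /z natrX wsq -exprM.
    by rewrite natrD mulr_natl mulr2n lerD2l ler1n ltnW.
  have -> : 2%:R * sq ^+ 8 * (x * sq ^+ 2) = x * (sq ^+ 8 * (2%:R * sq ^+ 2)) by ring.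
  rewrite -[x * y / sq]mulrA -[x * (y / sq) / 2%:R]mulrA ler_pM2l //.
  rewrite ler_pdivlMr // ler_pdivlMr //.
  apply: le_trans Ysq; apply: (@le_trans _ _ (sq ^+ 13)); last by rewrite ler_weXn2l //; clear - sq2; lra.
  have -> : sq ^+ 13 = sq ^+ 2 * sq ^+ 11 by rewrite -exprD.
  have -> : sq ^+ 8 * (2%:R * sq ^+ 2) * 2%:R * sq = 4%:R * sq ^+ 11 by ring.
  by apply: ler_wpM2r; [rewrite exprn_ge0 // ltW|clear - sq2; nra].
have A2 : (2 * X * b * trunc_log z X)%:R <= x * y * sq^-1 / 2%:R.
  rewrite !natrM -/x.
  apply: (@le_trans _ _ (2%:R * x * (2%:R * y / w%:R) * (25%:R * l))).
    apply: ler_pM => //; first by rewrite !mulr_ge0 // ltW.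
    by apply: ler_wpM2l => //; rewrite mulr_ge0 // ltW.
  have C4' : 100%:R * l <= sq / 2%:R by move: C4; rewrite expr1 -/sq; clear - l1; lra.
  have -> : 2%:R * x * (2%:R * y / w%:R) * (25%:R * l) = (x * y / sq ^+ 2) * (100%:R * l).
    by rewrite wsq; field; rewrite gt_eqF.
  have -> : x * y / sq / 2%:R = (x * y / sq ^+ 2) * (sq / 2%:R).
    by field; rewrite gt_eqF.
  by apply: ler_wpM2l => //; rewrite divr_ge0 ?mulr_ge0 ?exprn_ge0 // ltW.
apply: le_trans (lerD A1 A2) _; rewrite le_eqVlt; apply/orP; left; apply/eqP.
by field; rewrite gt_eqF.
Qed.

(** * Orders, the Carmichael function and Bonferroni's inequalities *)

Lemma ordmod_expn n a : (0 < n)%N -> coprime a n -> (a ^ ordmod n a = 1 %[mod n])%N.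
Proof.
move=> n0 an; rewrite /ordmod; set P := fun k => _.
have hasP : has P (iota 0 n).
  apply/hasP; exists (totient n).-1.
    rewrite mem_iota add0n /= prednK ?totient_gt0 // totient_count_coprime.
    apply: (@leq_trans (\sum_(0 <= d < n) 1)); last by rewrite sum_nat_const_nat subn0 muln1.
    by apply: leq_sum => i _; case: coprime.
  by rewrite /P prednK ?totient_gt0 // Euler_exp_totient.
have := nth_find 0%N hasP; rewrite nth_iota ?add0n; first by move/eqP.
by rewrite has_find size_iota in hasP.
Qed.

Lemma ordmod_min n a k : (0 < n)%N -> coprime a n -> (0 < k)%N -> (a ^ k = 1 %[mod n])%N ->
  (ordmod n a <= k)%N.
Proof.
move=> n0 an k0 ak; rewrite leqNgt; apply/negP; rewrite /ordmod ltnS => H.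
have kf : (k.-1 < find (fun k => a ^ k.+1 == 1 %[mod n]) (iota 0 n))%N by rewrite prednK.
have := before_find 0%N kf; rewrite nth_iota ?add0n ?prednK ?ak ?eqxx //.
by apply: leq_trans H _; apply: leq_trans (find_size _ _) _; rewrite size_iota.
Qed.

Lemma ordmod_dvd n a k : (0 < n)%N -> coprime a n ->
  (ordmod n a %| k)%N = (a ^ k == 1 %[mod n])%N.
Proof.
move=> n0 an; have o1 := ordmod_expn n0 an; set o := ordmod n a in o1 *.
have red : (a ^ k = a ^ (k %% o) %[mod n])%N.
  rewrite {1}(divn_eq k o) expnD mulnC [(_ %/ o * o)%N]mulnC expnM -modnMmr -modnXm o1.
  by rewrite modnXm exp1n modnMmr muln1.
apply/idP/eqP => [/eqP E|ak]; first by rewrite red E expn0.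
apply/negPn/negP => ne; have := ordmod_min n0 an (k := (k %% o)%N).
rewrite -red ak lt0n => /(_ ne erefl); rewrite -/o leqNgt ltn_mod.
by [].
Qed.

Lemma carmichael_gt0 n : (0 < carmichael n)%N.
Proof. by rewrite /carmichael; elim/big_ind: _ => // x y x0 y0; rewrite lcmn_gt0 x0. Qed.

Lemma carmichael_expn n a : (0 < n)%N -> coprime a n -> (a ^ carmichael n = 1 %[mod n])%N.
Proof.
move=> n0 an; rewrite -modnXm; apply/eqP.
have an' : coprime (a %% n) n by rewrite coprime_modl.
rewrite -ordmod_dvd //; exact: (biglcmn_sup (Ordinal (ltn_pmod a n0))).
Qed.

Lemma carmichael_dvd n k : (0 < n)%N -> (forall a, coprime a n -> (a ^ k = 1 %[mod n])%N) ->
  (carmichael n %| k)%N.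
Proof.
move=> n0 H; apply/dvdn_biglcmP => a an; rewrite ordmod_dvd //; apply/eqP; exact: H.
Qed.

Lemma carmichael_le n : (0 < n)%N -> (carmichael n <= n)%N.
Proof.
move=> n0; apply: (@leq_trans (totient n)); last first.
  rewrite totient_count_coprime.
  apply: (@leq_trans (\sum_(0 <= d < n) 1)); last by rewrite sum_nat_const_nat subn0 muln1.
  by apply: leq_sum => i _; case: coprime.
apply: dvdn_leq; first by rewrite totient_gt0.
by apply: carmichael_dvd => // a an; exact: Euler_exp_totient.
Qed.

(** A finite abelian group has an element whose order is the exponent of the group. *)
Lemma carmichael_witness n : (0 < n)%N ->
  exists2 g, coprime g n & ordmod n g = carmichael n.
Proof.
move=> n0; have [n1|n1] := leqP n 1.
  have -> : n = 1%N by lia.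
  exists 1%N => //; apply/eqP; rewrite eqn_dvd; apply/andP; split.
    by rewrite ordmod_dvd // exp1n.
  by apply: carmichael_dvd => // a _; rewrite !modn1.
have abG : abelian [set: {unit 'Z_n}] by exact: units_Zp_abelian.
have [x _ xe] := exponent_witness (abelian_nil abG).
have xk (y : {unit 'Z_n}) k : (((FinRing.uval y : 'Z_n) : nat) ^ k == 1 %[mod n])%N = (y ^+ k == 1)%g.
  rewrite -!val_Zp_nat // natrX natr_Zp; apply/eqP/eqP => [E|/(congr1 val) /=].
    by apply: val_inj; rewrite /= FinRing.val_unitX; apply: val_inj.
  by rewrite FinRing.val_unitX => ->.
have cu (y : {unit 'Z_n}) : coprime (FinRing.uval y : 'Z_n) n.
  by rewrite coprime_sym -unitZpE // natr_Zp; exact: (valP y).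
exists (FinRing.uval x : 'Z_n) => //; apply/eqP; rewrite eqn_dvd; apply/andP; split.
  by rewrite ordmod_dvd // carmichael_expn.
apply: carmichael_dvd => // a an.
have ua : (a%:R : 'Z_n) \is a GRing.unit by rewrite unitZpE // coprime_sym.
pose y : {unit 'Z_n} := FinRing.Unit ua.
have : (y ^+ ordmod n (FinRing.uval x : 'Z_n) == 1)%g.
  apply/eqP; apply/(exponentP (A := [set: {unit 'Z_n}])); last by rewrite inE.
  by rewrite xe order_dvdn -xk -ordmod_dvd.
by rewrite -xk /= val_Zp_nat // => /eqP; rewrite modnXm.
Qed.

(** The order divides [l = carmichael n]; if it is a proper divisor, it divides [l / q] for any
    prime [q] dividing the quotient. *)
Lemma lprimE n a : (0 < n)%N -> lprim a n =
  coprime a n && all (fun q => a ^ (carmichael n %/ q) != 1 %[mod n]) (primes (carmichael n)).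
Proof.
move=> n0; rewrite /lprim; case: (boolP (coprime a n)) => //= an.
have l0 := carmichael_gt0 n; set l := carmichael n in l0 *.
have ol : (ordmod n a %| l)%N by rewrite ordmod_dvd // carmichael_expn.
apply/eqP/allP => [E q|H].
  rewrite mem_primes => /and3P [qp _ ql]; rewrite -ordmod_dvd // E.
  apply/negP => /dvdn_leq; rewrite divn_gt0 ?prime_gt0 // dvdn_leq // => /(_ isT).
  by rewrite leqNgt ltn_Pdiv // prime_gt1.
apply/eqP/negPn/negP => ne.
have o0 : (0 < ordmod n a)%N by [].
have m1 : (1 < l %/ ordmod n a)%N.
  rewrite ltn_neqAle divn_gt0 // (dvdn_leq l0 ol) andbT eq_sym.
  by apply: contra ne => /eqP E; rewrite -(divnK ol) E mul1n.
set q := pdiv (l %/ ordmod n a).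
have qp : prime q by exact: pdiv_prime.
have ql : (q * ordmod n a %| l)%N.
  by rewrite -(divnK ol) dvdn_pmul2r // pdiv_dvd.
have qin : q \in primes l by rewrite mem_primes qp l0 (dvdn_trans _ ql) // dvdn_mulr.
have := H q qin; rewrite -ordmod_dvd // => /negP; apply.
move/dvdnP: ql => [k ->]; rewrite mulnCA mulnC mulnK ?prime_gt0 //.
exact: dvdn_mull.
Qed.

Definition carm_prime (n : nat) (i : 'I_(size (primes (carmichael n)))) : nat :=
  nth 0%N (primes (carmichael n)) i.

(* The simultaneous failure, at the primes of [carmichael n] indexed by [K], of the criterion lprimE. *)
Definition defect (n : nat) (K : {set 'I_(size (primes (carmichael n)))}) : pred nat :=
  fun a => coprime a n && [forall i in K, a ^ (carmichael n %/ carm_prime i) == 1 %[mod n]].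

Lemma carm_primeP n i : prime (@carm_prime n i) /\ (carm_prime i %| carmichael n)%N.
Proof.
have : @carm_prime n i \in primes (carmichael n) by exact: mem_nth.
by rewrite mem_primes => /and3P[].
Qed.

Lemma carm_prime_inj n : injective (@carm_prime n).
Proof.
move=> i j /eqP; rewrite /carm_prime nth_uniq ?primes_uniq // => /eqP E; exact: val_inj.
Qed.

(** The primes are listed in increasing order. Hence the sum of their reciprocals is at most a
    harmonic sum over their number, of order [ln (ln X)]. *)
Lemma carm_prime_ge n (i : 'I_(size (primes (carmichael n)))) : (i < carm_prime i)%N.
Proof.
have so : sorted ltn (primes (carmichael n)) by exact: sorted_primes.
have [j jn] : exists j : nat, (j < size (primes (carmichael n)))%N /\ j = i by exists i.
rewrite /carm_prime; case: jn => + <-.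
elim: j => [|j IH] js; first by have [/prime_gt0] := carm_primeP (Ordinal js).
apply: leq_ltn_trans (IH (ltnW js)) _.
by rewrite (sorted_ltn_nth ltn_trans) // inE // ltnW.
Qed.

Lemma defect_submonoid n K : (0 < n)%N -> residue_submonoid n (@defect n K).
Proof.
move=> n0; split.
- by rewrite /defect coprime1n /=; apply/forall_inP => i _; rewrite exp1n.
- move=> a b /andP [an /forall_inP Ha] /andP [bn /forall_inP Hb].
  rewrite /defect coprimeMl an bn /=; apply/forall_inP => i iK.
  by rewrite expnMn -modnMm (eqP (Ha i iK)) (eqP (Hb i iK)) modnMm.
- move=> a b ab; rewrite /defect (coprime_congr ab); congr (_ && _).
  by apply: eq_forallb => i; rewrite -modnXm ab modnXm.
- by move=> a /andP[].
Qed.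

Lemma dvdn_prod_primes (s : seq nat) m : uniq s -> all prime s ->
  (forall p, p \in s -> p %| m)%N -> (\prod_(p <- s) p %| m)%N.
Proof.
elim: s => [|p s IH]; first by rewrite big_nil dvd1n.
move=> /= /andP [ps us] /andP [pp sp] H; rewrite big_cons Gauss_dvd.
  by rewrite H ?mem_head // IH // => q qs; apply: H; rewrite inE qs orbT.
rewrite prime_coprime //; elim: s ps sp {us IH H} => [|q s IH] /=.
  by rewrite big_nil dvdn1 => _ _; rewrite gtn_eqF // prime_gt1.
rewrite inE negb_or => /andP [pq ps] /andP [qp sp].
by rewrite big_cons Euclid_dvdM // negb_or dvdn_prime2 // pq IH.
Qed.

Lemma residuesE n (H : pred nat) : residues n H = #|[set a : 'I_n | H a]|.
Proof.
rewrite /residues -sum1_card big_mkcond [RHS]big_mkcond /=; apply: eq_bigr => a _.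
by rewrite inE; case: (H a).
Qed.

Lemma dvdn_sub_eq j j' k : (j <= j')%N -> (j' < k)%N -> (k %| j' - j)%N -> j = j'.
Proof. by move=> jj jk /dvdnP [[|q]]; lia. Qed.

(* The cosets of the subgroup [defect K] by [g ^ j], [j < \prod q], are distinct when [g] has order [carmichael n]. *)
Lemma residues_defect n (K : {set 'I_(size (primes (carmichael n)))}) : (0 < n)%N ->
  (residues n (defect K) * \prod_(i in K) carm_prime i <= n)%N.
Proof.
move=> n0; set k := (\prod_(i in K) _)%N; have l0 : (0 < carmichael n)%N := carmichael_gt0 n.
have [g gn go] := carmichael_witness n0.
have dvdk m : (forall i, i \in K -> carm_prime i %| m)%N -> (k %| m)%N.
  move=> Hm; rewrite /k -big_enum -(big_map (@carm_prime n) xpredT id) /=.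
  apply: dvdn_prod_primes.
  - by rewrite map_inj_uniq ?enum_uniq //; exact: carm_prime_inj.
  - by apply/allP => p /mapP [i _ ->]; case: (carm_primeP i).
  - by move=> p /mapP [i]; rewrite mem_enum => iK ->; exact: Hm.
pose f (cj : 'I_n * 'I_k) : 'I_n := Ordinal (ltn_pmod (cj.1 * g ^ cj.2) n0).
set A := finset.setX [set a : 'I_n | defect K a] [set: 'I_k].
have cancel_g c c' m : (c * g ^ m = c' * g ^ m %[mod n])%N -> (c = c' %[mod n])%N.
  wlog cc : c c' / (c <= c')%N.
    move=> W E; case: (leqP c c') => [|/ltnW] cc; first exact: W.
    by apply/esym; apply: W.
  move/eqP; rewrite eq_sym eqn_mod_dvd ?leq_mul2r ?cc ?orbT // -mulnBl Gauss_dvdl; last first.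
    by rewrite coprime_sym coprimeXl.
  by rewrite -eqn_mod_dvd // eq_sym => /eqP.
have finj : {in A &, injective f}.
  have key c c' j j' : defect K c -> defect K c' -> (j <= j')%N -> (j' < k)%N ->
      (c * g ^ j = c' * g ^ j' %[mod n])%N -> j = j'.
    move=> /andP [cn /forall_inP Hc] /andP [cn' /forall_inP Hc'] jj jk E.
    have E2 : (c = c' * g ^ (j' - j) %[mod n])%N.
      by apply: (cancel_g _ _ j); rewrite E -mulnA -expnD subnK.
    have : (k %| j' - j)%N.
      apply: dvdk => i iK; have [qp ql] := carm_primeP i.
      have : (g ^ ((j' - j) * (carmichael n %/ carm_prime i)) == 1 %[mod n])%N.
        have := eqP (Hc i iK); rewrite -modnXm E2 modnXm expnMn -modnMml (eqP (Hc' i iK)) modnMml.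
        by rewrite mul1n -expnM => ->.
      rewrite -ordmod_dvd // go -{1}(divnK ql) [((j' - j) * _)%N]mulnC dvdn_pmul2l //.
      by rewrite divn_gt0 ?prime_gt0 // dvdn_leq.
    exact: dvdn_sub_eq.
  move=> [c j] [c' j'] /=; rewrite !finset.in_setX !inE !andbT /= => Hc Hc' /(congr1 val) /= E.
  have jj : j = j'.
    apply: val_inj; case: (leqP j j') => [|/ltnW] jj.
      exact: (key _ _ _ _ Hc Hc' jj (ltn_ord _) E).
    by apply/esym; exact: (key _ _ _ _ Hc' Hc jj (ltn_ord _) (esym E)).
  rewrite jj in E *; congr (_, _); apply: val_inj.
  by have := cancel_g _ _ _ E; rewrite !modn_small.
have := max_card (mem (f @: A)); rewrite card_in_imset // /A cardsX cardsT !card_ord.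
by rewrite residuesE.
Qed.

(** * Truncated inclusion-exclusion *)

Lemma alternating_bin (R : comRingType) m t :
  \sum_(i < t.+1) (-1) ^+ i * 'C(m.+1, i)%:R = (-1) ^+ t * 'C(m, t)%:R :> R.
Proof.
elim: t => [|t IH]; first by rewrite big_ord_recl big_ord0 !bin0 addr0.
by rewrite big_ord_recr /= IH binS natrD exprS; ring.
Qed.

(** If [B] has [m + 1] elements, the truncated sum is [(-1) ^ t * C(m, t)], and
    [C(m, t) <= C(m + 1, t + 1)]; for empty [B] the error vanishes. *)
Lemma bonferroni (R : realDomainType) (T : finType) (B : {set T}) t :
  `|(B == finset.set0)%:R - \sum_(K : {set T} | (#|K| < t.+1)%N) (-1) ^+ #|K| * (K \subset B)%:R|
  <= \sum_(K : {set T} | #|K| == t.+1) (K \subset B)%:R :> R.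
Proof.
have cnt k : \sum_(K : {set T} | #|K| == k) (K \subset B)%:R = 'C(#|B|, k)%:R :> R.
  rewrite -cards_draws -sum1_card natr_sum [LHS]big_mkcond [RHS]big_mkcond /=.
  by apply: eq_bigr => K _; rewrite inE; case: (#|K| == k); case: (K \subset B).
have -> : \sum_(K : {set T} | (#|K| < t.+1)%N) (-1) ^+ #|K| * (K \subset B)%:R =
   \sum_(i < t.+1) (-1) ^+ i * 'C(#|B|, i)%:R :> R.
  rewrite (partition_big (fun K : {set T} => inord #|K| : 'I_t.+1) xpredT) //=.
  apply: eq_bigr => i _; rewrite -cnt mulr_sumr; apply: eq_big => K.
    apply/andP/eqP => [[Kt /eqP <-]|E]; first by rewrite inordK.
    by rewrite E ltn_ord; split=> //; apply/eqP; apply: val_inj; rewrite /= inordK.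
  by case/andP => Kt /eqP <-; rewrite inordK.
rewrite cnt -cards_eq0; case: (#|B|) => [|m].
  rewrite eqxx big_ord_recl big1 ?addr0 ?bin0 ?mulr1 ?expr0 ?subrr ?normr0 //.
  by move=> i _; rewrite bin0n mulr0.
rewrite alternating_bin /= sub0r normrN normrM normrX normrN normr1 expr1n mul1r normr_nat.
by rewrite ler_nat binS leq_addl.
Qed.

Lemma card_small_sets (T : finType) t :
  (#|[set K : {set T} | (#|K| <= t)%N]| <= #|T|.+1 ^ t)%N.
Proof.
have -> : (#|[set K : {set T} | (#|K| <= t)%N]| = \sum_(i < t.+1) 'C(#|T|, i))%N.
  rewrite -sum1_card (partition_big (fun K : {set T} => inord #|K| : 'I_t.+1) xpredT) //=.
  apply: eq_bigr => i _; rewrite -card_draws -sum1_card; apply: eq_bigl => K; rewrite !inE.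
  apply/andP/eqP => [[Kt /eqP <-]|E]; first by rewrite inordK.
  by rewrite E -ltnS ltn_ord; split=> //; apply/eqP; apply: val_inj; rewrite /= inordK.
elim: t => [|t IH]; first by rewrite big_ord_recl big_ord0 bin0.
rewrite big_ord_recr /= expnS mulSn; apply: leq_add; first exact: IH.
apply: (@leq_trans (#|T| * 'C(#|T|, t))).
  apply: (@leq_trans (t.+1 * 'C(#|T|, t.+1))%N); first by rewrite leq_pmull.
  by rewrite mul_bin_left leq_mul2r leq_subr orbT.
by rewrite leq_mul2l; apply/orP; right; apply: leq_trans IH; rewrite big_ord_recr leq_addl.
Qed.

Lemma harmonic_sum_mono (R : realType) M N : (M <= N)%N -> harmonic_sum R M <= harmonic_sum R N.
Proof.
move=> MN; rewrite /harmonic_sum [leRHS](big_cat_nat (n := M.+1)) //= lerDl.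
by apply: sumr_ge0 => k _; rewrite invr_ge0.
Qed.

(* An elementary symmetric function of the [1 / q] is at most [u ^- t] times the product of the [1 + u / q]. *)
Lemma carm_esym_le (R : realType) n t (u : R) : 0 < u ->
  \sum_(K : {set 'I_(size (primes (carmichael n)))} | #|K| == t)
     \prod_(i in K) (carm_prime i)%:R^-1 <=
  (u ^+ t)^-1 * expR (u * harmonic_sum R (size (primes (carmichael n)))).
Proof.
move=> u0; set N := size _.
have q0 (i : 'I_N) : (0 : R) < (@carm_prime n i)%:R.
  by rewrite ltr0n; case: (carm_primeP i) => /prime_gt0.
rewrite mulrC ler_pdivlMr ?exprn_gt0 // mulr_suml.
apply: (@le_trans _ _ (\sum_(K : {set 'I_N}) \prod_(i in K) (u / (carm_prime i)%:R))).
  rewrite [leRHS](bigID (fun K : {set 'I_N} => #|K| == t)) /=.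
  rewrite -[leLHS]addr0; apply: lerD; last first.
    by apply: sumr_ge0 => K _; apply: prodr_ge0 => i _; rewrite divr_ge0 // ltW.
  apply: ler_sum => K /eqP <-; rewrite big_split /= prodr_const mulrC.
  by rewrite le_refl.
have -> : \sum_(K : {set 'I_N}) \prod_(i in K) (u / (carm_prime i)%:R) =
   \prod_(i < N) (u / (carm_prime i)%:R + 1) :> R.
  rewrite bigA_distr /=; apply: eq_big => [K|K _]; first by rewrite inE.
  by rewrite big_mkcond.
apply: (@le_trans _ _ (\prod_(i < N) expR (u / (carm_prime i)%:R))).
  apply: ler_prod => i _; rewrite addr_ge0 ?divr_ge0 ?ler0n ?(ltW u0) //= addrC.
  exact: expR_ge1Dx.
rewrite -expR_sum ler_expR -mulr_sumr ler_pM2l // /harmonic_sum big_add1 big_mkord.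
apply: ler_sum => i _; rewrite lef_pV2 ?posrE ?ltr0n // ?ler_nat ?carm_prime_ge //.
by case: (carm_primeP i) => /prime_gt0.
Qed.

(** Apply [bonferroni] to the set [B] of primes at which the criterion [lprimE] fails: [defect K a]
    says that [K] lies in [B]. *)
Lemma lprim_bonferroni (R : realType) n a t : (0 < n)%N ->
  `|(lprim a n)%:R - \sum_(K : {set 'I_(size (primes (carmichael n)))} | (#|K| < t.+1)%N)
      (-1) ^+ #|K| * (defect K a)%:R|
  <= \sum_(K : {set 'I_(size (primes (carmichael n)))} | #|K| == t.+1) (defect K a)%:R :> R.
Proof.
move=> n0; rewrite lprimE //; case: (boolP (coprime a n)) => an /=; last first.
  have d0 (K : {set 'I_(size (primes (carmichael n)))}) : defect K a = false.
    by rewrite /defect (negbTE an).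
  rewrite !big1 => [|K _|K _]; rewrite ?d0 ?mulr0 ?subrr ?normr0 //.
pose B : {set 'I_(size (primes (carmichael n)))} :=
  [set i | a ^ (carmichael n %/ carm_prime i) == 1 %[mod n]].
have dE K : defect K a = (K \subset B).
  rewrite /defect an /=; apply/forall_inP/fintype.subsetP => H i iK.
    by rewrite inE H.
  by have := H i iK; rewrite inE.
have -> : all (fun q => (a ^ (carmichael n %/ q))%N != 1 %[mod n]) (primes (carmichael n)) =
    (B == finset.set0).
  apply/allP/eqP => [H|H].
    apply/finset.setP => i; rewrite !inE; apply/negbTE; apply: H; exact: mem_nth.
  move=> q /(nthP 0%N) [i iN <-]; have : Ordinal iN \notin B by rewrite H inE.
  by rewrite inE.
have := @bonferroni R _ B t.
under [X in _ - X]eq_bigr do rewrite -dE.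
by under [X in _ <= X]eq_bigr do rewrite -dE.
Qed.

Lemma size_primes_carmichael n X : (0 < n <= X)%N ->
  (size (primes (carmichael n)) <= trunc_log 2 X)%N.
Proof.
move=> /andP [n0 nX]; have l0 := carmichael_gt0 n.
apply: trunc_log_max => //; apply: leq_trans (_ : _ <= carmichael n)%N _; last first.
  exact: leq_trans (carmichael_le n0) nX.
apply: leq_trans (@pow2_omega_le _ (carmichael n) _) _; first by rewrite l0 leqnn.
apply: (@leq_trans (\sum_(1 <= a < (carmichael n).+1) 1)%N).
  by apply: leq_sum => a _; case: (_ %| _)%N.
by rewrite sum_nat_const_nat subn1 muln1.
Qed.

(** Bonferroni is used for the [a <= Y] and for a full residue system, and the results are compared.
    The layer of sets of size [t + 1] is the error in both, hence the factor 2; for the [a <= Y] it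
    is first reduced to residues at the cost of further deviations. All deviations are replaced by
    the largest, so a single subgroup remains. *)
Lemma lprim_deviation (R : realType) n X Y t (u : R) : (0 < n <= X)%N -> 0 < u ->
  exists2 H, residue_submonoid n H &
  `|\sum_(1 <= a < Y.+1) (lprim a n)%:R - Y%:R * (Rcount n)%:R / n%:R| <=
  ((trunc_log 2 X).+1 ^ t.+1)%:R * `|(hits H Y)%:R - Y%:R * (residues n H)%:R / n%:R| +
  2%:R * Y%:R * ((u ^+ t.+1)^-1 * expR (u * harmonic_sum R (trunc_log 2 X))) :> R.
Proof.
move=> nX u0; have /andP [n0 _] := nX; set N := size (primes (carmichael n)).
have n0' : (0 : R) < n%:R by rewrite ltr0n.
have NX : (N <= trunc_log 2 X)%N := size_primes_carmichael nX.
pose dev (K : {set 'I_N}) : R :=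
  (hits (defect K) Y)%:R - Y%:R * (residues n (defect K))%:R / n%:R.
pose Km := [arg max_(K > (finset.set0 : {set 'I_N})) `|dev K|]%O.
have Kmax K : `|dev K| <= `|dev Km|.
  by rewrite /Km; case: arg_maxP => // K0 _; apply.
exists (defect Km); first exact: defect_submonoid.
rewrite -/(dev Km).
pose L : R := \sum_(1 <= a < Y.+1) (lprim a n)%:R.
pose r : R := (Rcount n)%:R.
pose h (K : {set 'I_N}) : R := (residues n (defect K))%:R.
pose A (K : {set 'I_N}) : R := (hits (defect K) Y)%:R.
pose sg (K : {set 'I_N}) : R := (-1) ^+ #|K|.
have nsg K : `|sg K| = 1 by rewrite /sg normrX normrN normr1 expr1n.
have HL : `|L - \sum_(K : {set 'I_N} | (#|K| < t.+1)%N) sg K * A K| <=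
   \sum_(K : {set 'I_N} | #|K| == t.+1) A K.
  have AE K : A K = \sum_(1 <= a < Y.+1) (defect K a)%:R by rewrite /A /hits natr_sum.
  under [X in _ - X]eq_bigr do rewrite AE mulr_sumr.
  under [leRHS]eq_bigr do rewrite AE.
  rewrite exchange_big /= [leRHS]exchange_big /= /L -sumrB.
  apply: le_trans (ler_norm_sum _ _ _) _; apply: ler_sum => a _.
  exact: lprim_bonferroni.
have Hr : `|r - \sum_(K : {set 'I_N} | (#|K| < t.+1)%N) sg K * h K| <=
   \sum_(K : {set 'I_N} | #|K| == t.+1) h K.
  have hE K : h K = \sum_(a < n) (defect K a)%:R by rewrite /h /residues natr_sum.
  have rE : r = \sum_(a < n) (lprim a n)%:R.
    by rewrite /r -natr_sum -[(\sum_(a < n) _)%N]/(residues n (fun a => lprim a n)) residuesE.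
  under [X in _ - X]eq_bigr do rewrite hE mulr_sumr.
  under [leRHS]eq_bigr do rewrite hE.
  rewrite exchange_big /= [leRHS]exchange_big /= rE -sumrB.
  apply: le_trans (ler_norm_sum _ _ _) _; apply: ler_sum => a _.
  exact: lprim_bonferroni.
have Yn0 : 0 <= Y%:R / n%:R :> R by rewrite divr_ge0.
set M1 := \sum_(K | _) sg K * A K in HL; set m1 := \sum_(K | _) sg K * h K in Hr.
have E1 : L - Y%:R * r / n%:R = (L - M1) + (M1 - Y%:R / n%:R * m1) - Y%:R / n%:R * (r - m1).
  by rewrite mulrBr; ring.
rewrite -/L -/r E1.
have B3 : `|M1 - Y%:R / n%:R * m1| <= \sum_(K : {set 'I_N} | (#|K| < t.+1)%N) `|dev K|.
  rewrite /M1 /m1 mulr_sumr -sumrB; apply: le_trans (ler_norm_sum _ _ _) _.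
  apply: ler_sum => K _; rewrite mulrCA -mulrBr normrM nsg mul1r /dev.
  by rewrite [Y%:R / n%:R * _]mulrAC.
have B4 : \sum_(K : {set 'I_N} | #|K| == t.+1) A K <=
   \sum_(K : {set 'I_N} | #|K| == t.+1) `|dev K| +
   Y%:R / n%:R * \sum_(K : {set 'I_N} | #|K| == t.+1) h K.
  rewrite mulr_sumr -big_split /=; apply: ler_sum => K _.
  rewrite -lerBlDr; apply: le_trans (ler_norm _).
  by rewrite /dev [Y%:R / n%:R * _]mulrAC.
have B5 : Y%:R / n%:R * \sum_(K : {set 'I_N} | #|K| == t.+1) h K <=
   Y%:R * ((u ^+ t.+1)^-1 * expR (u * harmonic_sum R (trunc_log 2 X))).
  rewrite -mulrA; apply: ler_wpM2l => //.
  apply: (@le_trans _ _ (\sum_(K : {set 'I_N} | #|K| == t.+1) \prod_(i in K) (carm_prime i)%:R^-1)).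
    rewrite mulr_sumr; apply: ler_sum => K _.
    have p0 : (0 : R) < \prod_(i in K) (carm_prime i)%:R.
      by apply: prodr_gt0 => i _; rewrite ltr0n; case: (carm_primeP i) => /prime_gt0.
    rewrite prodfV mulrC ler_pdivrMr // mulrC ler_pdivlMr // -natr_prod -natrM ler_nat.
    exact: residues_defect.
  apply: le_trans (carm_esym_le _ _ u0) _.
  rewrite ler_pM2l ?invr_gt0 ?exprn_gt0 // ler_expR ler_pM2l //.
  exact: harmonic_sum_mono.
have B6 : \sum_(K : {set 'I_N} | (#|K| < t.+1)%N) `|dev K| +
   \sum_(K : {set 'I_N} | #|K| == t.+1) `|dev K| <=
   ((trunc_log 2 X).+1 ^ t.+1)%:R * `|dev Km|.
  have -> : \sum_(K : {set 'I_N} | (#|K| < t.+1)%N) `|dev K| +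
     \sum_(K : {set 'I_N} | #|K| == t.+1) `|dev K| =
     \sum_(K in [set K : {set 'I_N} | (#|K| <= t.+1)%N]) `|dev K|.
    rewrite [RHS](bigID (fun K : {set 'I_N} => (#|K| < t.+1)%N)) /=; congr (_ + _);
      apply: eq_bigl => K; rewrite inE.
      by rewrite [(#|K| <= t.+1)%N]leq_eqVlt; case: (#|K| < t.+1)%N; rewrite ?orbT ?andbF.
    by rewrite -leqNgt -eqn_leq.
  apply: le_trans (ler_sum _ (fun K _ => Kmax K)) _.
  rewrite sumr_const -[leLHS]mulr_natl; apply: ler_wpM2r => //.
  rewrite ler_nat; apply: leq_trans (card_small_sets _ _) _.
  by rewrite card_ord leq_exp2r.
have T1 := ler_normB ((L - M1) + (M1 - Y%:R / n%:R * m1)) (Y%:R / n%:R * (r - m1)).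
have T2 := ler_normD (L - M1) (M1 - Y%:R / n%:R * m1).
have T3 : `|Y%:R / n%:R * (r - m1)| <= Y%:R / n%:R * \sum_(K : {set 'I_N} | #|K| == t.+1) h K.
  by rewrite normrM ger0_norm // ler_wpM2l.
lra.
Qed.

(** * The average of N_a(x) *)

Lemma nat_root k Y : (0 < k)%N -> exists w, (w ^ k <= Y)%N /\ (Y < w.+1 ^ k)%N.
Proof.
move=> k0; elim: Y => [|Y [w [wY Yw]]]; first by exists 0%N; rewrite exp0n // exp1n.
have [H|H] := ltnP Y.+1 (w.+1 ^ k)%N; first by exists w; split=> //; exact: ltnW.
exists w.+1; split=> //; apply: leq_trans (_ : w.+1 ^ k < _)%N; last by rewrite ltn_exp2r.
by rewrite ltnS.
Qed.

Lemma sum_Ncount (R : realType) X Y :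
  \sum_(1 <= a < Y.+1) (Ncount a X)%:R =
  \sum_(1 <= n < X.+1) \sum_(1 <= a < Y.+1) (lprim a n)%:R :> R.
Proof.
rewrite exchange_big /=; apply: eq_bigr => a _; rewrite -natr_sum; congr _%:R.
rewrite /Ncount -sum1_card big_geq_mkord big_mkcond [RHS]big_mkcond /=; apply: eq_bigr => n _.
by rewrite inE; case: (0 < n)%N; case: (lprim a n).
Qed.

Lemma Rcount_le n : (Rcount n <= n)%N.
Proof. by rewrite -[leqRHS]card_ord; exact: max_card. Qed.

Lemma lprim_sum_deviation (R : realType) X Y t (u B : R) : 0 < u ->
  (forall H : nat -> pred nat, (forall n, (0 < n <= X)%N -> residue_submonoid n (H n)) ->
    \sum_(1 <= n < X.+1) `|(hits (H n) Y)%:R - Y%:R * (residues n (H n))%:R / n%:R| <= B) ->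
  `|\sum_(1 <= n < X.+1) \sum_(1 <= a < Y.+1) (lprim a n)%:R -
     Y%:R * \sum_(1 <= n < X.+1) (Rcount n)%:R / n%:R| <=
  ((trunc_log 2 X).+1 ^ t.+1)%:R * B +
  X%:R * (2%:R * Y%:R * ((u ^+ t.+1)^-1 * expR (u * harmonic_sum R (trunc_log 2 X)))).
Proof.
move=> u0 HB; set E := 2%:R * _ * _.
have /boolp.choice [H HH] : forall n, exists H, (0 < n <= X)%N -> residue_submonoid n H /\
    `|\sum_(1 <= a < Y.+1) (lprim a n)%:R - Y%:R * (Rcount n)%:R / n%:R| <=
    ((trunc_log 2 X).+1 ^ t.+1)%:R * `|(hits H Y)%:R - Y%:R * (residues n H)%:R / n%:R| + E.
  move=> n; case: (boolP (0 < n <= X)%N) => [nX|_]; last by exists xpred0.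
  by have [H H1 H2] := @lprim_deviation R n X Y t u nX u0; exists H.
have {}HB := HB H (fun n nX => proj1 (HH n nX)).
rewrite mulr_sumr -sumrB; apply: le_trans (ler_norm_sum _ _ _) _.
apply: (@le_trans _ _ (\sum_(1 <= n < X.+1) (((trunc_log 2 X).+1 ^ t.+1)%:R *
   `|(hits (H n) Y)%:R - Y%:R * (residues n (H n))%:R / n%:R| + E))).
  rewrite big_nat [leRHS]big_nat; apply: ler_sum => n; rewrite ltnS => nX.
  by rewrite mulrA; exact: (proj2 (HH n nX)).
rewrite big_split /= -mulr_sumr; apply: lerD; first exact: ler_wpM2l.
by rewrite big_const_nat iter_addr_0 subn1 mulr_natl.
Qed.

(** Here [4.2 / 40 = 21 / 200] exceeds [1 / 10] by [1 / 200], and the surplus [exp (s / 200) >= 2]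
    absorbs the rounding from [w + 1] to [w]. *)
Lemma root_lower_bound (R : realType) (s y : R) w : 200%:R <= s ->
  expR (42%:R / 10%:R * s) < y -> y < (w.+1 ^ 40)%:R -> s / 10%:R <= ln w%:R.
Proof.
move=> s200 sy yw.
have w1 : expR (21%:R / 200%:R * s) < w.+1%:R.
  rewrite -(@ltr_pXn2r _ 40) ?nnegrE ?expR_ge0 ?ler0n // -natrX -expRM_natl.
  apply: le_lt_trans (lt_trans sy yw); rewrite ler_expR; clear - s200; lra.
have e1 : 2%:R <= expR (s / 200%:R) by apply: le_trans (expR_ge1Dx _); lra.
have e2 : 1 <= expR (s / 10%:R) by apply: le_trans (expR_ge1Dx _); lra.
have w2 : expR (s / 10%:R) <= w%:R.
  have : expR (21%:R / 200%:R * s) = expR (s / 10%:R) * expR (s / 200%:R).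
    by rewrite -expRD; congr expR; lra.
  move: w1; rewrite -[w.+1%:R]natr1 => w1 E; nra.
rewrite -[leLHS]expRK ler_ln ?posrE ?expR_gt0 //; exact: lt_le_trans (expR_gt0 _) w2.
Qed.

(** The weight is [u = exp (p / 2)], the square root of [s], and [t] is about [s / (100 * p)]. As
    [log_2 X + 1 <= s ^ 3], the number of sets has logarithm at most
    [3 * p * (t + 1) <= 3 * s / 100 + s / 100]. In the tail, [u ^ -(t + 1)] gives [exp (- s / 200)],
    while the harmonic sum is at most [1 + 3 * p] and costs only [exp (s / 400)]. *)
Lemma truncation_parameters (R : realType) (p s : R) X : s = expR p -> 1 <= p ->
  1200%:R * (1 + p) ^+ 1 <= expR (2%:R^-1 * p) -> 200%:R <= s -> (0 < X)%N ->
  ln (X%:R : R) <= s ^+ 2 ->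
  exists2 t, ((trunc_log 2 X).+1 ^ t.+1)%:R <= expR (s / 25%:R) &
    (expR (p / 2%:R) ^+ t.+1)^-1 * expR (expR (p / 2%:R) * harmonic_sum R (trunc_log 2 X))
      <= expR (- (s / 400%:R)).
Proof.
move=> sE p1; rewrite expr1 => Cp s200 X0 lX.
have d0 : 0 < 100%:R * p by apply: mulr_gt0; lra.
have s0 : 0 <= s by lra.
pose t := Num.truncn (s / (100%:R * p)).
have /andP [t1 t2] : t%:R <= s / (100%:R * p) < t.+1%:R.
  exact: (truncn_itv (divr_ge0 s0 (ltW d0))).
have M1 : (trunc_log 2 X).+1%:R <= expR (3%:R * p).
  have -> : expR (3%:R * p) = s ^+ 3 by rewrite expRM_natl -sE.
  have := @trunc_log2_le_ln R X X0; rewrite -[_.+1%:R]natr1.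
  have s3 : 200%:R * s ^+ 2 <= s ^+ 3 by rewrite [s ^+ 3]exprS ler_wpM2r // sqr_ge0.
  have s2 : 1 <= s ^+ 2 by rewrite exprn_ege1 //; clear - s200; lra.
  by move: (s ^+ 2) (s ^+ 3) s2 s3 lX => a b; clear; lra.
exists t.
  rewrite natrX; apply: (@le_trans _ _ (expR (3%:R * p) ^+ t.+1)).
    by apply: lerXn2r; rewrite ?nnegrE ?ler0n ?expR_ge0.
  rewrite -expRM_natr ler_expR -[t.+1%:R]natr1.
  have tp : t%:R * (100%:R * p) <= s by rewrite -ler_pdivlMr.
  have : 300%:R * p <= s.
    apply: (@le_trans _ _ (1200%:R * (1 + p))); first by clear - p1; lra.
    by apply: le_trans Cp _; rewrite sE ler_expR; clear - p1; lra.
  by move: (t%:R) tp => a; clear; nra.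
rewrite -expRM_natr -expRN -expRD ler_expR.
have h1 : harmonic_sum R (trunc_log 2 X) <= 1 + 3%:R * p.
  apply: le_trans (harmonic_sum_mono R (leqnSn _)) _.
  apply: le_trans (@harmonic_sum_le R _ (ltn0Sn _)) _; rewrite lerD2l.
  by rewrite -[leRHS]expRK ler_ln ?posrE ?expR_gt0 ?ltr0n.
have tp : s <= t.+1%:R * (100%:R * p) by rewrite -ler_pdivrMr // ltW.
have h2 : expR (p / 2%:R) * harmonic_sum R (trunc_log 2 X) <= s / 400%:R.
  apply: (@le_trans _ _ (expR (p / 2%:R) * (expR (p / 2%:R) / 400%:R))).
    rewrite ler_pM2l ?expR_gt0 //; apply: le_trans h1 _; move: Cp.
    by rewrite [2%:R^-1 * p]mulrC; move: (expR _) => r; clear; lra.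
  by rewrite mulrA -expRD -splitr -sE.
by move: h2 tp; move: (expR _ * _) t.+1%:R => a b; clear; lra.
Qed.

Theorem theorem2p1 (R : realType) :
  exists c13 : R, 0 < c13 /\
  exists C : R, 0 < C /\
  exists x0 : R, forall x y : R, x0 <= x ->
    expR (42%:R / 10%:R * Num.sqrt (ln x)) < y ->
    `| y^-1 * (\sum_(1 <= a < (Num.truncn y).+1) (Ncount a (Num.truncn x))%:R)
       - \sum_(1 <= n < (Num.truncn x).+1) (Rcount n)%:R / n%:R |
    <= C * x * expR (- c13 * Num.sqrt (ln x)).
Proof.
have [L0 HL0] := family_deviation_small R.
have [p0 Hp0] := @poly_le_expR R 1200%:R 2%:R^-1 1 ltac:(lra).
(* The smaller of two savings: the Bonferroni tail gives [s / 400], equidistribution gives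
   [s / 20 - s / 25 = s / 100]. *)
exists 400%:R^-1; split; first by lra.
(* One unit for equidistribution, two for the Bonferroni tails, one for replacing the integer part
   of [y] by [y]. *)
exists 4%:R; split; first by lra.
pose S0 : R := Num.max 200%:R (Num.max (10%:R * L0) (expR (Num.max p0 1))).
exists (expR (S0 ^+ 2)) => x y xx0 sy; set s := Num.sqrt (ln x) in sy *.
have S200 : 200%:R <= S0 by rewrite le_max lexx.
have x1 : 1 <= x by apply: le_trans xx0; apply: le_trans (expR_ge1Dx _); nra.
have x0 : 0 < x by lra.
have lnx : ln x = s ^+ 2 by rewrite sqr_sqrtr // ln_ge0.
have sS : S0 <= s.
  rewrite -(ler_pXn2r (n := 2)) // ?nnegrE ?sqrtr_ge0 //; last by clear - S200; lra.
  by rewrite -lnx -[leLHS]expRK ler_ln ?posrE ?expR_gt0.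
have [s200 sL sp] : [/\ 200%:R <= s, 10%:R * L0 <= s & expR (Num.max p0 1) <= s].
  by move: sS; rewrite !ge_max => /and3P[].
have s0 : 0 < s by clear - s200; lra.
set p := ln s; have sE : s = expR p by rewrite lnK.
have /andP [pp0 p1] : (p0 <= p) && (1 <= p).
  by rewrite -ge_max /p -[leLHS]expRK ler_ln ?posrE ?expR_gt0.
have {Hp0}Cp := Hp0 _ pp0.
set X := Num.truncn x; set Y := Num.truncn y.
have y0 : 0 < y by apply: lt_trans sy; exact: expR_gt0.
have /andP [Yy yY] : Y%:R <= y < Y.+1%:R by exact: (truncn_itv (ltW y0)).
have /andP [Xx xX] : X%:R <= x < X.+1%:R by exact: (truncn_itv (ltW x0)).
have X0 : (0 < X)%N by rewrite truncn_gt0.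
have X0' : (0 : R) < X%:R by rewrite ltr0n.
have [w [wY Yw]] := @nat_root 40 Y isT.
have lw : s / 10%:R <= ln w%:R.
  apply: (root_lower_bound s200 sy); apply: lt_le_trans yY _.
  by rewrite ler_nat.
have w0 : (0 < w)%N.
  by rewrite lt0n; apply/eqP => E; move: lw; rewrite E ln0 //; clear - s0; lra.
have lX : ln (X%:R : R) <= s ^+ 2 by rewrite -lnx ler_ln.
have KP (H : nat -> pred nat) : (forall n, (0 < n <= X)%N -> residue_submonoid n (H n)) ->
   \sum_(1 <= n < X.+1) `|(hits (H n) Y)%:R - Y%:R * (residues n (H n))%:R / n%:R| <=
   X%:R * Y%:R * expR (- (s / 20%:R)) :> R.
  move=> Hs; apply: le_trans (HL0 w X Y H w0 _ X0 wY Yw _ Hs) _.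
  - by clear - lw sL; lra.
  - by apply: le_trans lX _; move: (ln w%:R) lw => l lw; clear - lw s0; nra.
  - by apply: ler_wpM2l; rewrite ?mulr_ge0 // ler_expR; clear - lw; lra.
have [t V1 V2] := truncation_parameters sE p1 Cp s200 X0 lX.
have u0 : 0 < expR (p / 2%:R) by exact: expR_gt0.
have main := lprim_sum_deviation t u0 KP.
have sumR : \sum_(1 <= n < X.+1) (Rcount n)%:R / n%:R <= X%:R :> R.
  apply: (@le_trans _ _ (\sum_(1 <= n < X.+1) 1)); last first.
    by rewrite big_const_nat iter_addr_0 subn1.
  rewrite big_nat [leRHS]big_nat; apply: ler_sum => n /andP [n0 _].
  by rewrite ler_pdivrMr ?ltr0n // mul1r ler_nat Rcount_le.
have sumR0 : 0 <= \sum_(1 <= n < X.+1) (Rcount n)%:R / n%:R :> R.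
  by apply: sumr_ge0 => n _; rewrite divr_ge0.
rewrite sum_Ncount; set L := \sum_(1 <= n < X.+1) \sum_(_ <= a < _) _ in main *.
set S := \sum_(1 <= n < X.+1) _ in main sumR sumR0 *.
set e := expR (- (s / 400%:R)) in V2 *.
have -> : - 400%:R^-1 * s = - (s / 400%:R) by rewrite mulNr mulrC.
rewrite -/e; have e0 : 0 < e by exact: expR_gt0.
have m1 : `|L - Y%:R * S| <= 3%:R * (X%:R * y * e).
  apply: le_trans main _.
  have a1 : ((trunc_log 2 X).+1 ^ t.+1)%:R * (X%:R * Y%:R * expR (- (s / 20%:R))) <= X%:R * y * e.
    apply: (@le_trans _ _ (expR (s / 25%:R) * (X%:R * y * expR (- (s / 20%:R))))).
      apply: ler_pM; [exact: ler0n| |exact: V1|by rewrite ler_pM2r ?expR_gt0 // ler_pM2l].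
      by apply: mulr_ge0 (expR_ge0 _); exact: mulr_ge0.
    rewrite mulrCA; apply: ler_wpM2l; first by rewrite mulr_ge0 // ltW.
    by rewrite -expRD ler_expR; clear - s0; lra.
  have a2 : X%:R * (2%:R * Y%:R * ((expR (p / 2%:R) ^+ t.+1)^-1 *
       expR (expR (p / 2%:R) * harmonic_sum R (trunc_log 2 X)))) <= 2%:R * (X%:R * y * e).
    have -> : 2%:R * (X%:R * y * e) = X%:R * (2%:R * y * e) by ring.
    rewrite ler_pM2l //; apply: ler_pM; [exact: mulr_ge0| |by rewrite ler_pM2l|exact: V2].
    by apply: mulr_ge0 (expR_ge0 _); rewrite invr_ge0 exprn_ge0 ?expR_ge0.
  by apply: le_trans (lerD a1 a2) _; move: (X%:R * y * e) => r; clear; lra.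
(* Rounding [y] costs at most [S <= X], which is affordable since [y * e >= 1]. *)
have m2 : `|(y - Y%:R) * S| <= X%:R * y * e.
  have d0 : 0 <= y - Y%:R by rewrite subr_ge0.
  have d1 : y - Y%:R <= 1 by rewrite lerBlDr addrC natr1 ltW.
  rewrite normrM (ger0_norm d0) (ger0_norm sumR0).
  have ye : 1 <= y * e.
    apply: (@le_trans _ _ (expR (42%:R / 10%:R * s) * e)); last by rewrite ler_pM2r // ltW.
    by rewrite /e -expRD -[leLHS]expR0 ler_expR; clear - s0; lra.
  apply: (@le_trans _ _ X%:R); last by rewrite -mulrA ler_peMr // ltW.
  by apply: le_trans sumR; exact: ler_piMl.
have -> : y^-1 * L - S = y^-1 * ((L - Y%:R * S) - (y - Y%:R) * S).
  by field; rewrite gt_eqF.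
rewrite normrM gtr0_norm ?invr_gt0 // mulrC ler_pdivrMr //.
apply: le_trans (ler_normB _ _) _; apply: le_trans (lerD m1 m2) _.
have : X%:R * y * e <= x * y * e by rewrite -!mulrA ler_pM2r // mulr_gt0.
have -> : 4%:R * x * e * y = 4%:R * (x * y * e) by ring.
by move: (X%:R * y * e) (x * y * e) => r r'; clear; lra.
Qed.
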